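(* Let $\nu(\beta)=2e^{-\beta/2}(1-e^{-\beta/2})$ if $\beta\le2\ln2$ and $\nu(\beta)=1/2$ if $\beta\ge2\ln2$. Any algorithm for maximizing a non-negative submodular function $f\colon 2^{\mathcal N}\to\mathbb R_{\ge0}$ over a cardinality constraint that guarantees $(\nu(\beta)+\delta,\beta)$-bicriteria approximation for constants $\beta\ge0$ and $\delta>0$ must use an exponential number of value oracle queries.
   Context: $f$ is submodular if $f(S\cup\{u\})-f(S)\ge f(T\cup\{u\})-f(T)$ for all $S\subseteq T\subseteq\mathcal N$, $u\notin T$; $f$ is accessed only via a value oracle. A cardinality constraint with integer budget $B$ declares $S$ feasible iff $|S|\le B$. Let $OPT$ be a feasible set maximizing $f$. An $(\alpha,\beta)$-bicriteria approximation algorithm outputs $S$ with $\mathbb E[f(S)]\ge\alpha f(OPT)$ and $|S|\le\beta B$. *)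

(* Defs.v *)
From HB Require Import structures.
From mathcomp Require Import all_boot all_order all_algebra.
From mathcomp Require Import all_classical all_reals all_analysis.
Set Implicit Arguments. Unset Strict Implicit. Unset Printing Implicit Defensive.
Import Order.TTheory GRing.Theory Num.Theory.
Local Open Scope ring_scope.

Definition nu {R : realType} (beta : R) : R :=
  if beta <= 2 * ln 2 then 2 * expR (- (beta / 2)) * (1 - expR (- (beta / 2)))
  else 1 / 2.

Definition submodular {R : realType} {n : nat} (f : {set 'I_n} -> R) : Prop :=
  forall (S T : {set 'I_n}) (u : 'I_n), S \subset T -> u \notin T ->
    f (u |: S) - f S >= f (u |: T) - f T.

Definition nonneg_fun {R : realType} {n : nat} (f : {set 'I_n} -> R) : Prop :=
  forall S, 0 <= f S.

(* A deterministic adaptive value-oracle algorithm on ground set 'I_n: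
   a decision tree which either outputs a set, or queries f at a set Q and
   continues depending on the (real) answer f Q. *)
Inductive oalg (R : Type) (n : nat) : Type :=
  | Ret of {set 'I_n}
  | Ask of {set 'I_n} & (R -> oalg R n).

Fixpoint run {R : Type} {n : nat} (f : {set 'I_n} -> R) (a : oalg R n)
  : {set 'I_n} :=
  match a with
  | Ret X => X
  | Ask Q k => run f (k (f Q))
  end.

Fixpoint nqueries {R : Type} {n : nat} (f : {set 'I_n} -> R) (a : oalg R n)
  : nat :=
  match a with
  | Ret _ => 0%N
  | Ask Q k => (nqueries f (k (f Q))).+1
  end.

(* Main.v *)
(** The ground set contains [d] pairs and [kap * d] blocks of size [N]. A secret
    picks one point of every pair (the set [a]; let [a'] be the other points) and
    one point of every block (the set [O]). With [q] and [q'] the fractions of [a]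
    and [a'] that are taken, the objective combines the cut value
    [q (1 - q') + q' (1 - q)] with [(1 - q) Y + (1 - q') Y'], where [Y] and [Y']
    are coverage functions of the blocks: in the symmetric version ([gsym]) both
    treat all points alike, in the secret version ([gsym + hpart]) [O] alone
    covers [Y'] completely. Taking [a] and [O] is worth [1 - c], whereas a
    symmetric set is worth at most [2 c (1 - c) ^ 2], where [c] is
    [1 - e ^ (- beta / 2)] or, for large [beta], [1 / 2]; the ratio is [nu beta].

    Since [hpart] vanishes to second order at symmetric sets, it can be multiplied
    by a factor [damp] that is exactly zero near them and depends on the squared
    distance [rad] to symmetry only through its logarithm: the second differences
    of [damp * hpart] then exceed those of an interpolation of the two submodular
    versions by only [O(rho)] at every scale, which [rho' * slack] absorbs. By
    Chernoff bounds a fixed query set separates the secret instance from the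
    symmetric one for an exponentially small fraction of the secrets, so an
    algorithm with few queries behaves on most secrets as on the symmetric
    instance. *)
Require Import Defs.
From HB Require Import structures.
From mathcomp Require Import all_boot all_order all_algebra.
From mathcomp Require Import all_classical all_reals all_analysis.
From mathcomp Require Import measurable_realfun ring lra.
Set Implicit Arguments. Unset Strict Implicit. Unset Printing Implicit Defensive.
Import Order.TTheory GRing.Theory Num.Theory.
Local Open Scope ring_scope.

(** * The squared positive part and the logarithm *)

Section SquaredPositivePart.
Variable R : realType.
Implicit Types x y : R.

(** Zero on a half-line, yet with second differences never larger than those of the square. In [cut]
    and [damp] it removes the dependence on the secret near symmetric sets. *)
Definition sqpos x := Num.max x 0 ^+ 2.

Lemma sqpos_ge0 x : 0 <= sqpos x. Proof. exact: sqr_ge0. Qed.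

Lemma sqpos_eq0 x : x <= 0 -> sqpos x = 0.
Proof. by move=> x0; rewrite /sqpos max_r// expr0n. Qed.

Lemma sqpos_pos x : 0 <= x -> sqpos x = x ^+ 2.
Proof. by move=> x0; rewrite /sqpos max_l. Qed.

Lemma sqpos_le1 x : x <= 1 -> sqpos x <= 1.
Proof.
move=> x1; have [x0|/ltW x0] := leP x 0; first by rewrite sqpos_eq0.
by rewrite sqpos_pos// expr_le1.
Qed.

Lemma sqpos_lip (c x y : R) : 0 <= c -> x <= c -> y <= c ->
  `|sqpos x - sqpos y| <= 2 * c * `|x - y|.
Proof.
move=> c0; wlog xy : x y / y <= x.
  move=> H xc yc; have [yx|/ltW yx] := leP y x; first exact: H.
  by rewrite distrC [`|x - y|]distrC; apply: H.
move=> xc yc; rewrite [`|x - y|]ger0_norm ?subr_ge0//.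
have [y0|/ltW y0] := leP y 0; have [x0|/ltW x0] := leP x 0.
- by rewrite !sqpos_eq0// subrr normr0 mulr_ge0 ?subr_ge0 ?mulr_ge0.
- by rewrite (sqpos_eq0 y0) sqpos_pos// subr0 ger0_norm ?sqr_ge0//; nra.
- by rewrite (_ : x = y) ?subrr ?normr0 ?mulr0//; apply/le_anti; rewrite xy (le_trans x0).
- by rewrite !sqpos_pos// ger0_norm; nra.
Qed.

(** The derivative of the squared positive part is 2-Lipschitz. For nonnegative steps the bound is
    checked according to which corners are positive. *)
Lemma sqpos_diff2 (l a b : R) :
  `|sqpos (l + a + b) - sqpos (l + a) - sqpos (l + b) + sqpos l|
  <= 2 * `|a| * `|b|.
Proof.
have key (l' a' b' : R) : 0 <= a' -> 0 <= b' ->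
   `|sqpos (l' + a' + b') - sqpos (l' + a') - sqpos (l' + b') + sqpos l'|
   <= 2 * a' * b'.
  move=> a0 b0; wlog ab : a' b' a0 b0 / a' <= b'.
    move=> H; have [ab|/ltW ab] := leP a' b'; first exact: H.
    have := H b' a' b0 a0 ab.
    rewrite (_ : l' + b' + a' = l' + a' + b'); last by ring.
    rewrite (_ : 2 * b' * a' = 2 * a' * b'); last by ring.
    by congr (`| _ | <= _); ring.
  rewrite ler_norml.
  have [h4|/ltW h4] := leP (l' + a' + b') 0.
    rewrite !sqpos_eq0; try lra; nra.
  rewrite (sqpos_pos h4).
  have [h3|/ltW h3] := leP (l' + b') 0.
    rewrite !(sqpos_eq0, sqpos_eq0 h3); try lra; nra.
  rewrite (sqpos_pos h3).
  have [h2|/ltW h2] := leP (l' + a') 0.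
    rewrite !(sqpos_eq0, sqpos_eq0 h2); try lra; nra.
  rewrite (sqpos_pos h2).
  have [h1|/ltW h1] := leP l' 0.
    rewrite (sqpos_eq0 h1); nra.
  rewrite (sqpos_pos h1); nra.
(* A negative step is reversed by moving the base point to another corner of the parallelogram; each
   reversal flips the sign of the second difference. *)
have [a0|/ltW a0] := leP 0 a; have [b0|/ltW b0] := leP 0 b.
- by rewrite (ger0_norm a0) (ger0_norm b0); exact: key.
- rewrite (ger0_norm a0) (ler0_norm b0); have := key (l + b) a (- b) a0.
  rewrite oppr_ge0 => /(_ b0); rewrite -normrN; congr (`| _ | <= _).
  have -> : l + b + a + - b = l + a by ring.
  have -> : l + b + a = l + a + b by ring.
  have -> : l + b - b = l by ring. ring.
- rewrite (ler0_norm a0) (ger0_norm b0); have := key (l + a) (- a) b.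
  rewrite oppr_ge0 => /(_ a0 b0); rewrite -normrN; congr (`| _ | <= _).
  have -> : l + a - a + b = l + b by ring.
  have -> : l + a - a = l by ring. ring.
- rewrite (ler0_norm a0) (ler0_norm b0); have := key (l + a + b) (- a) (- b).
  rewrite !oppr_ge0 => /(_ a0 b0); congr (`| _ | <= _).
  have -> : l + a + b - a - b = l by ring.
  have -> : l + a + b - a = l + b by ring.
  have -> : l + a + b - b = l + a by ring. ring.
Qed.

Lemma ln_norm_le x : `|x| <= 1 / 2 -> `|ln (1 + x)| <= 2 * `|x|.
Proof.
rewrite ler_norml => /andP[x1 x2].
have p1 : 0 < 1 + x by lra.
have up : ln (1 + x) <= x by apply: le_ln1Dx; lra.
have lo : - (2 * `|x|) <= ln (1 + x).
  have : ln ((1 + x)^-1) <= (1 + x)^-1 - 1.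
    have := @le_ln1Dx R ((1 + x)^-1 - 1).
    rewrite addrCA subrr addr0; apply.
    by rewrite ltrBrDl subrr invr_gt0.
  rewrite lnV ?posrE// => h.
  suff : (1 + x)^-1 - 1 <= 2 * `|x| by lra.
  rewrite lerBlDr -[(1+x)^-1]mul1r ler_pdivrMr//.
  by have [x0|x0] := leP 0 x; [rewrite ger0_norm|rewrite ltr0_norm]; nra.
rewrite ler_norml lo /= (le_trans up)//.
by have [x0|x0] := leP 0 x; [rewrite ger0_norm|rewrite ltr0_norm]; lra.
Qed.

End SquaredPositivePart.

(** * Second differences of the base functions *)

(* [KA], [KB]: the point of a pair that belongs to [a], resp. does not;
   [KO], [KS]: a point of a block that belongs to [O], resp. does not. *)
Inductive kind := KA | KB | KO | KS.

(* A set seen through the secret: [sm + su] and [sm - su] are the fractions of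
   [a] and of its complement that it takes, [2 * so] is the fraction of [O], and
   [sv], [sp] are [1 - eta] to the number of block points inside, resp. outside,
   [O], so that [sp * sv] is independent of the secret. *)
Record state (R : Type) := State {sm : R; su : R; so : R; sp : R; sv : R}.

Section States.
Variables (R : realType) (zeta eta : R).
Hypothesis eta_gt0 : 0 < eta.
Hypothesis eta_le_zeta : eta <= zeta.

Definition dm k : R := match k with KA | KB => zeta | _ => 0 end.
Definition du k : R := match k with KA => zeta | KB => - zeta | _ => 0 end.
Definition de k : R := if k is KO then eta else 0.
Definition ds k : R := if k is KS then eta else 0.

Definition add_kind k (x : state R) :=
  State (sm x + dm k) (su x + du k) (so x + de k)
        (sp x * (1 - ds k)) (sv x * (1 - de k)).

Definition diff2 (F : state R -> R) k l x :=
  F (add_kind l (add_kind k x)) - F (add_kind k x) - F (add_kind l x) + F x.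

(** All that is used about states coming from sets. The bounds on [su] say that both fractions
    [sm + su] and [sm - su] lie in [0,1]; the bounds on [sv] are of Bonferroni type, with [sv] a
    product of factors [1 - eta] and [so] the corresponding sum of [eta]. *)
Record valid (x : state R) : Prop := Valid {
  vum : `|su x| <= sm x; vu1m : `|su x| <= 1 - sm x;
  vo0 : 0 <= so x; vo2 : 2 * so x <= 1;
  vp0 : 0 < sp x; vp1 : sp x <= 1;
  vv0 : 1 - so x <= sv x; vv1 : sv x <= 1; vv2 : sv x <= 1 - so x + so x ^+ 2 }.

(** With q = m + u and q' = m - u, half of q (1 - q') + q' (1 - q) is m (1 - m) + u^2. Here u^2 is
    replaced by a truncated square that is zero for u <= eps. *)
Definition cut eps (x : state R) := sm x * (1 - sm x) + sqpos (su x - eps).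
Definition gsym (x : state R) := (1 - sm x) * (1 - sp x * sv x).
(** Chosen so that [gsym + hpart] is half of (1 - q) Y + (1 - q') Y' with Y = 1 - p and Y' = 1 - (1
    - 2 o) p, where p is [sp] and o is [so]. *)
Definition hpart (x : state R) :=
  sp x * ((1 - sm x) * (sv x - 1 + so x) + su x * so x).
(** A function independent of the secret and strictly submodular in every pair of directions, with a
    margin proportional to [sp], as is the error caused by damping. *)
Definition slack (x : state R) :=
  (2 - sm x) * (1 - sp x * sv x) + sm x * (2 - sm x).
Definition rad (x : state R) := su x ^+ 2 + so x ^+ 2.
(** The factor [sp] under the logarithm makes the damping take effect also on sets with very many
    block points, for which [so] need not be small. *)
Definition lam rho (x : state R) := 1 + rho * ln (sp x * rad x).
Definition damp rho (x : state R) := sqpos (lam rho x).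

Lemma zeta_gt0 : 0 < zeta. Proof. exact: lt_le_trans eta_le_zeta. Qed.
Lemma dm_ge0 k : 0 <= dm k. Proof. by case: k => //=; exact: ltW zeta_gt0. Qed.
Lemma de_ge0 k : 0 <= de k. Proof. by case: k => //=; exact: ltW. Qed.
Lemma ds_ge0 k : 0 <= ds k. Proof. by case: k => //=; exact: ltW. Qed.
Lemma norm_du k : `|du k| = dm k.
Proof. by case: k => /=; rewrite ?normr0 ?normrN ?ger0_norm ?(ltW zeta_gt0). Qed.

Lemma gsym_D2 k l x : diff2 gsym k l x =
  - (sp x * sv x * ((1 - sm x) * (de k + ds k) * (de l + ds l)
       + dm k * (de l + ds l) + dm l * (de k + ds k))).
Proof. case: x k l => m u o p v [] []; rewrite /diff2 /gsym /=; ring. Qed.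

(** The two groups come from (1 - q) Y and (1 - q') Y'. In this form every product consists of
    factors that are nonnegative on valid states. *)
Lemma fhid_D2 k l x : 2 * diff2 (fun y => gsym y + hpart y) k l x =
  - (sp x *
     ((1 - sm x - su x) * ds k * ds l
      + (dm k + du k) * ds l + (dm l + du l) * ds k))
  - (sp x *
     (2 * (dm k - du k) * de l + 2 * (dm l - du l) * de k
      + (1 - 2 * so x) * ((dm k - du k) * ds l + (dm l - du l) * ds k)
      + 2 * (1 - sm x + su x) * (de k * ds l + de l * ds k)
      + (1 - sm x + su x) * (1 - 2 * so x) * ds k * ds l)).
Proof.
case: x k l => m u o p v [] []; rewrite /diff2 /gsym /hpart /=; ring.
Qed.

Lemma slack_D2 k l x : diff2 slack k l x =
  - (sp x * sv x * ((2 - sm x) * (de k + ds k) * (de l + ds l)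
       + dm k * (de l + ds l) + dm l * (de k + ds k))) - 2 * dm k * dm l.
Proof. case: x k l => m u o p v [] []; rewrite /diff2 /slack /=; ring. Qed.

Section Valid.
Variable x : state R.
Hypothesis vx : valid x.

Lemma valid_m0 : 0 <= sm x. Proof. exact: le_trans (vum vx). Qed.
Lemma valid_m1 : sm x <= 1.
Proof. by rewrite -subr_ge0; exact: le_trans (vu1m vx). Qed.
Lemma valid_v2 : 1 / 2 <= sv x.
Proof. by have := vv0 vx; have := vo2 vx; lra. Qed.

Lemma gsym_D2_le0 k l : diff2 gsym k l x <= 0.
Proof.
rewrite gsym_D2 oppr_le0.
have := (valid_m1, valid_v2, vp0 vx, dm_ge0 k, dm_ge0 l, de_ge0 k, de_ge0 l,
   ds_ge0 k, ds_ge0 l) => -[[[[[[[[m1 v2] p0] ?] ?] ?] ?] ?] ?].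
have v0 : 0 <= sv x by lra.
have p0' := ltW p0; have m1' : 0 <= 1 - sm x by rewrite subr_ge0.
by move: (1 - sm x) m1' => A A0; rewrite !(mulr_ge0, addr_ge0).
Qed.

Lemma fhid_D2_le0 k l : diff2 (fun y => gsym y + hpart y) k l x <= 0.
Proof.
have dB j : 0 <= dm j - du j by rewrite -norm_du subr_ge0 ler_norm.
have dA j : 0 <= dm j + du j.
  by rewrite -norm_du -lerBlDr sub0r -normrN ler_norm.
have h1 : 0 <= 1 - sm x - su x.
  by rewrite subr_ge0 (le_trans _ (vu1m vx))// ler_norm.
have h2 : 0 <= 1 - sm x + su x.
  by rewrite -lerBlDr sub0r (le_trans _ (vu1m vx))// -normrN ler_norm.
have h3 : 0 <= 1 - 2 * so x by rewrite subr_ge0 (vo2 vx).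
have p0 := ltW (vp0 vx).
have := (de_ge0 k, de_ge0 l, ds_ge0 k, ds_ge0 l) => -[[[ok ol] sk] sl].
rewrite -(pmulr_rle0 _ (@ltr0Sn R 1)) fhid_D2 -opprD oppr_le0.
move: (dB k) (dB l) (dA k) (dA l) h1 h2 h3.
move: (dm k - du k) (dm l - du l) (dm k + du k) (dm l + du l)
  (1 - sm x - su x) (1 - sm x + su x) (1 - 2 * so x) => ? ? ? ? ? ? ?.
by move=> ? ? ? ? ? ? ?; rewrite !(mulr_ge0, addr_ge0).
Qed.

(** Each combination of kinds meets a strictly negative term: two blocks the first product, a pair
    and a block a mixed one, two pairs the square of [dm]. The factor 1/2 is the lower bound on
    [sv]. *)
Lemma slack_D2_le k l : diff2 slack k l x <= - (1 / 2 * eta ^+ 2 * sp x).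
Proof.
have := (valid_m0, valid_m1, valid_v2, vp0 vx, vp1 vx, vv1 vx)
  => -[[[[[m0 m1] v2] p0] p1] v1].
rewrite slack_D2.
have := (ltW eta_gt0, eta_le_zeta) => -[e0 ez].
have pv : 1 / 2 * sp x <= sp x * sv x by nra.
have pv1 : sp x * sv x <= 1 by nra.
have e2 : 0 <= eta ^+ 2 by rewrite sqr_ge0.
have pve : 1 / 2 * eta ^+ 2 * sp x <= sp x * sv x * eta ^+ 2 by nra.
suff : sp x * sv x * eta ^+ 2 <=
  sp x * sv x * ((2 - sm x) * (de k + ds k) * (de l + ds l)
       + dm k * (de l + ds l) + dm l * (de k + ds k)) + 2 * dm k * dm l by lra.
have pv0 : 0 <= sp x * sv x by nra.
have ze : eta ^+ 2 <= zeta * eta by nra.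
have zz : eta ^+ 2 <= zeta * zeta by nra.
move: (sp x * sv x) pv0 pv1 => q q0 q1.
have E1 : q * eta ^+ 2 <= q * ((2 - sm x) * eta * eta).
  by rewrite ler_wpM2l//; nra.
have E2 : q * eta ^+ 2 <= q * (zeta * eta) by rewrite ler_wpM2l.
have E3 : q * eta ^+ 2 <= 2 * zeta * zeta by nra.
by case: k; case: l => /=; rewrite ?(addr0, add0r, mulr0, mul0r).
Qed.

(** The concave part contributes -2 [dm k * dm l], which outweighs the truncated square because
    [|du| = dm]. *)
Lemma cut_D2_le0 eps k l : diff2 (cut eps) k l x <= 0.
Proof.
have := sqpos_diff2 (su x - eps) (du k) (du l).
rewrite !norm_du ler_norml => /andP[_ h].
rewrite /diff2 /cut /=.
have -> : su x + du k + du l - eps = su x - eps + du k + du l by ring.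
have -> : su x + du k - eps = su x - eps + du k by ring.
have -> : su x + du l - eps = su x - eps + du l by ring.
nra.
Qed.

End Valid.

(** [vv0] and [vv2] put [sv - 1 + so] between 0 and [so ^+ 2], so both terms are of second order in
    the distance to symmetry. *)
Lemma hpart_bound r x : valid x -> `|su x| <= r -> so x <= r ->
  `|hpart x| <= 2 * sp x * r ^+ 2.
Proof.
move=> vx ur or; have m0 := valid_m0 vx; have m1 := valid_m1 vx.
have := (vo0 vx, vp0 vx, vv0 vx, vv2 vx) => -[[[oge p0] v0] v2].
rewrite /hpart normrM (ger0_norm (ltW p0)).
rewrite (_ : 2 * _ * _ = sp x * (2 * r ^+ 2)); last by ring.
rewrite ler_wpM2l ?(ltW p0)//.
rewrite (le_trans (ler_normD _ _))// !normrM (ger0_norm oge).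
have r0 : 0 <= r by apply: le_trans or.
have h1 : `|su x| * so x <= r * r by rewrite ler_pM.
rewrite (@ger0_norm _ (1 - sm x)) ?subr_ge0// (@ger0_norm _ (_ + so x)); last by lra.
have h2 : (1 - sm x) * (sv x - 1 + so x) <= so x ^+ 2.
  by rewrite -[leRHS]mul1r ler_pM//; lra.
have h3 : so x ^+ 2 <= r * r by rewrite ler_pM.
by rewrite expr2; lra.
Qed.

(** Each kind of step changes [hpart] by [sp] times the step size times a factor of first order,
    bounded by [2 * r]. *)
Lemma hpart_step r k x : valid x -> `|su x| <= r -> so x <= r ->
  `|hpart (add_kind k x) - hpart x| <= 2 * zeta * sp x * r.
Proof.
move=> vx ur or; have m0 := valid_m0 vx; have m1 := valid_m1 vx.
have := (eta_gt0, eta_le_zeta) => -[e0 ez].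
have := (vo0 vx, vp0 vx, vv0 vx, vv2 vx, vo2 vx, vu1m vx, vv1 vx)
  => -[[[[[[oge p0] v0] v2] o2] um] v1].
have r0 : 0 <= r by apply: le_trans or.
have u1 : `|su x| <= 1 by lra.
move/ler_normlP: (u1) (ur) => [u3 u4] /ler_normlP[ur1 ur2].
have z0 := zeta_gt0.
have main (E : R) : `|E| <= 2 * r -> forall e : R, 0 <= e <= zeta ->
    `|sp x * e * E| <= 2 * zeta * sp x * r.
  move=> Er e /andP[e1 e2]; rewrite !normrM (ger0_norm (ltW p0)) (ger0_norm e1).
  rewrite (_ : 2 * _ * _ * _ = sp x * zeta * (2 * r)); last by ring.
  by rewrite ler_pM// ?mulr_ge0 ?(ltW p0)// ler_wpM2l ?(ltW p0).
have z01 : 0 <= zeta <= zeta by rewrite lexx ltW.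
have e01 : 0 <= eta <= zeta by rewrite eta_le_zeta ltW.
case: k => /=; rewrite /hpart /=.
- rewrite (_ : _ - _ = sp x * zeta * (1 - sv x)); last by ring.
  by apply: (main _ _ _ z01); rewrite ler_norml; apply/andP; split; lra.
- rewrite (_ : _ - _ = sp x * zeta * (1 - sv x - 2 * so x)); last by ring.
  by apply: (main _ _ _ z01); rewrite ler_norml; apply/andP; split; lra.
- rewrite (_ : _ - _ = sp x * eta * ((1 - sm x) * (1 - sv x) + su x)); last by ring.
  apply: (main _ _ _ e01).
  have : 0 <= (1 - sm x) * (1 - sv x) <= so x.
    by rewrite mulr_ge0 ?subr_ge0//= -[leRHS]mul1r ler_pM//; lra.
  by move=> /andP[? ?]; rewrite ler_norml; apply/andP; split; lra.
- rewrite (_ : _ - _ = sp x * eta * (- ((1 - sm x) * (sv x - 1 + so x) + su x * so x)));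
    last by ring.
  apply: (main _ _ _ e01).
  have : 0 <= (1 - sm x) * (sv x - 1 + so x) <= so x.
    rewrite mulr_ge0//=; [|lra|lra].
    by rewrite -[leRHS]mul1r ler_pM//; [lra|lra|lra|nra].
  move=> /andP[? ?]; have ? : - so x <= su x * so x <= so x by apply/andP; split; nra.
  by rewrite normrN ler_norml; apply/andP; split; lra.
Qed.

End States.

(** * Logarithmic damping *)

Section LogDamping.
Variables (R : realType) (zeta eta : R).
Hypothesis eta_gt0 : 0 < eta.
Hypothesis eta_le_zeta : eta <= zeta.

Local Notation du := (du zeta).
Local Notation de := (de eta).
Local Notation ds := (ds eta).
Local Notation step := (add_kind zeta eta).
Local Notation D2 := (diff2 zeta eta).

Definition drad k (x : state R) :=
  2 * su x * du k + du k ^+ 2 + 2 * so x * de k + de k ^+ 2.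

Lemma rad_step k x : rad (step k x) = rad x + drad k x.
Proof. rewrite /rad /drad /=; ring. Qed.

Section Alive.
Variables (x : state R) (r delta : R).
Hypotheses (vx : valid x) (r_gt0 : 0 < r) (r_le1 : r <= 1).
Hypotheses (xr : rad x = r ^+ 2) (zr : zeta <= delta * r) (d100 : 100 * delta <= 1).

Lemma su_le_r : `|su x| <= r.
Proof.
rewrite -ler_sqr ?nnegrE ?normr_ge0 ?(ltW r_gt0)// -normrX ger0_norm ?sqr_ge0// -xr.
by rewrite /rad lerDl sqr_ge0.
Qed.

Lemma so_le_r : so x <= r.
Proof.
rewrite -ler_sqr ?nnegrE ?(vo0 vx) ?(ltW r_gt0)// -xr.
by rewrite /rad lerDr sqr_ge0.
Qed.

Lemma delta_gt0 : 0 < delta.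
Proof.
rewrite -(pmulr_lgt0 _ r_gt0); apply: lt_le_trans zr.
exact: lt_le_trans eta_le_zeta.
Qed.

Lemma drad_le k : `|drad k x| <= 3 * delta * r ^+ 2.
Proof.
have d0 := delta_gt0; have r0 := r_gt0; have dr := zr; have e0 := eta_gt0.
have ez := eta_le_zeta; have d1 := d100; have oge := vo0 vx; have or := so_le_r.
have /ler_normlP[u1 u2] := su_le_r.
have dr0 : 0 < delta * r by rewrite mulr_gt0.
have key (t e : R) : - r <= t <= r -> - (delta * r) <= e <= delta * r ->
  `|2 * t * e + e ^+ 2| <= 3 * delta * r ^+ 2.
  move=> tr er.
  have ht : `|t| <= r by rewrite ler_norml.
  have he : `|e| <= delta * r by rewrite ler_norml.
  apply: (le_trans (ler_normD _ _)).
  rewrite !normrM (@ger0_norm _ 2)//.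
  have h1 : `|t| * `|e| <= r * (delta * r) by rewrite ler_pM.
  have h2 : `|e| * `|e| <= (delta * r) * (delta * r) by rewrite ler_pM.
  have h3 : delta * r * (delta * r) <= delta * r * r.
    by rewrite ler_wpM2l ?(ltW dr0)//; nra.
  rewrite !expr2; lra.
rewrite /drad; case: k => /=.
- rewrite (_ : _ + _ = 2 * su x * zeta + zeta ^+ 2); last by ring.
  by apply: key; apply/andP; split; lra.
- rewrite (_ : _ + _ = 2 * su x * (- zeta) + (- zeta) ^+ 2); last by ring.
  by apply: key; apply/andP; split; lra.
- rewrite (_ : _ + _ = 2 * so x * eta + eta ^+ 2); last by ring.
  by apply: key; apply/andP; split; lra.
- rewrite !mulr0 !expr0n !addr0 /= normr0; nra.
Qed.

Local Notation mass := (fun y : state R => sp y * rad y).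

Lemma mass_gt0 : 0 < mass x.
Proof. by rewrite /= mulr_gt0 ?(vp0 vx)// xr exprn_gt0. Qed.

(** A step changes only one of the factors [sp] and [rad], and that one by a relative amount of at
    most [3 * delta]. *)
Lemma mass_step k : `|mass (step k x) - mass x| <= 3 * delta * mass x.
Proof.
have d0 := delta_gt0; have e0 := eta_gt0; have ez := eta_le_zeta.
have p0 := vp0 vx; have dr := drad_le k; have m0 := mass_gt0.
have dr0 : delta * r <= delta by rewrite -[leRHS]mulr1 ler_pM2l.
have key : drad k x = 0 \/ ds k = 0.
  by case: k {dr}; [right|right|right|left; rewrite /drad /=; ring].
have sk : 0 <= ds k <= delta.
  by case: k {dr key} => /=; apply/andP; split; have := zr; lra.
rewrite /= rad_step; case: key => E.
  rewrite E addr0 (_ : _ - _ = - (ds k * (sp x * rad x))); last by rewrite /=; ring.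
  by rewrite normrN normrM (gtr0_norm m0) ler_pM2r// ger0_norm; lra.
rewrite E (_ : _ - _ = sp x * drad k x); last by ring.
by rewrite normrM (gtr0_norm p0) xr mulrCA ler_pM2l.
Qed.

Lemma mass_step_ge k : 97 / 100 * mass x <= mass (step k x).
Proof.
have := mass_step k; have := mass_gt0; have := d100 => /= d1 m0.
rewrite ler_norml => /andP[h _].
have : delta * (sp x * rad x) <= 1 / 100 * (sp x * rad x) by rewrite ler_pM2r//; lra.
by lra.
Qed.

(** This cross difference of the four corner masses governs the mixed second difference of their
    logarithm. First-order terms cancel, and what is left pairs two increments of relative size
    [delta]. *)
Lemma mass_D2 k l :
  `|mass (step l (step k x)) * mass x - mass (step k x) * mass (step l x)|
  <= 11 * delta ^+ 2 * mass x ^+ 2.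
Proof.
have d0 := delta_gt0; have e0 := eta_gt0; have ez := eta_le_zeta.
have p0 := vp0 vx; have r0 := r_gt0.
have -> : mass (step l (step k x)) * mass x - mass (step k x) * mass (step l x) =
  sp x ^+ 2 * ((1 - ds k) * (1 - ds l)) *
    (2 * rad x * (du k * du l + de k * de l) - drad k x * drad l x).
  rewrite /= !rad_step /drad /rad /=; ring.
have dz : zeta <= delta * r by [].
have dr0 : 0 < delta * r by rewrite mulr_gt0.
have e1 : eta <= 1.
  rewrite (le_trans ez)// (le_trans dz)//.
  by rewrite mulr_ile1 ?(ltW r0) ?(ltW d0)//; have := d100; lra.
have s01 j : 0 <= 1 - ds j <= 1 by case: j => /=; apply/andP; split; lra.
have hs : `|(1 - ds k) * (1 - ds l)| <= 1.
  have /andP[a1 a2] := s01 k; have /andP[b1 b2] := s01 l.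
  by rewrite ger0_norm ?mulr_ge0// mulr_ile1.
have hb : `|du k * du l + de k * de l| <= delta ^+ 2 * r ^+ 2.
  have zz : zeta * zeta <= delta * r * (delta * r) by rewrite ler_pM// ltW// (lt_le_trans e0).
  have ee : eta * eta <= zeta * zeta by rewrite ler_pM// ltW.
  have zz0 : 0 <= zeta * zeta by rewrite (le_trans _ ee)// mulr_ge0 ?ltW.
  have ee0 : 0 <= eta * eta by rewrite mulr_ge0 ?ltW.
  rewrite ler_norml -exprMn expr2.
  by case: k l {hs} => -[] /=; apply/andP; split; lra.
have ha : `|drad k x * drad l x| <= (3 * delta * r ^+ 2) * (3 * delta * r ^+ 2).
  by rewrite normrM ler_pM// drad_le.
have hR : `|2 * rad x * (du k * du l + de k * de l) - drad k x * drad l x|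
   <= 11 * delta ^+ 2 * r ^+ 4.
  apply: (le_trans (ler_normB _ _)); rewrite normrM xr (@ger0_norm _ (2 * _)); last first.
    by rewrite mulr_ge0 ?sqr_ge0.
  have : 2 * r ^+ 2 * `|du k * du l + de k * de l| <= 2 * r ^+ 2 * (delta ^+ 2 * r ^+ 2).
    by rewrite ler_wpM2l// mulr_ge0 ?sqr_ge0.
  have -> : 2 * r ^+ 2 * (delta ^+ 2 * r ^+ 2) = 2 * (delta ^+ 2 * r ^+ 4) by ring.
  have -> : 11 * delta ^+ 2 * r ^+ 4 = 11 * (delta ^+ 2 * r ^+ 4) by ring.
  move: ha.
  have -> : (3 * delta * r ^+ 2) * (3 * delta * r ^+ 2) = 9 * (delta ^+ 2 * r ^+ 4) by ring.
  by lra.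
rewrite normrM (normrM (sp x ^+ 2)) (@ger0_norm _ (sp x ^+ 2)) ?sqr_ge0//.
rewrite -mulrA.
have -> : 11 * delta ^+ 2 * (mass x) ^+ 2 = sp x ^+ 2 * (1 * (11 * delta ^+ 2 * r ^+ 4)).
  rewrite /= xr; ring.
by rewrite ler_wpM2l ?sqr_ge0// ler_pM.
Qed.

Lemma lam_step rho k : 0 <= rho -> `|lam rho (step k x) - lam rho x| <= 6 * rho * delta.
Proof.
move=> rho0; have m0 := mass_gt0; have ms := mass_step k.
have mg := mass_step_ge k; rewrite /= in m0 ms mg.
have m1 : 0 < sp (step k x) * rad (step k x) by apply: lt_le_trans mg; lra.
rewrite /lam opprD addrACA subrr add0r -mulrBr normrM (ger0_norm rho0).
rewrite -ln_div ?posrE// (_ : 6 * _ * _ = rho * (6 * delta)); last by ring.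
rewrite ler_wpM2l//.
set q := _ / _.
have dq : `|q - 1| <= 3 * delta.
  rewrite -(ler_pM2r m0) -[X in _ * X](gtr0_norm m0) -normrM mulrBl mul1r.
  by rewrite /q divfK ?gt_eqF.
have -> : q = 1 + (q - 1) by ring.
rewrite (le_trans (ln_norm_le _))//; have := d100; lra.
Qed.

(** The second difference is [rho] times the logarithm of a cross ratio of masses that is within
    [22 * delta ^+ 2] of 1. Only relative sizes enter, so the bound is the same at every scale. *)
Lemma lam_D2 rho k l : 0 <= rho ->
  0 < sp (step l (step k x)) * rad (step l (step k x)) ->
  `|D2 (lam rho) k l x| <= 44 * rho * delta ^+ 2.
Proof.
move=> rho0 mkl; have m0 := mass_gt0; have d0 := delta_gt0; have d1 := d100.
have mgk := mass_step_ge k; have mgl := mass_step_ge l.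
have m2 := mass_D2 k l; rewrite /= in m0 mgk mgl m2.
set A := sp x * rad x in m0 mgk mgl m2.
set B := sp (step k x) * rad (step k x) in mgk m2.
set C := sp (step l x) * rad (step l x) in mgl m2.
set E := sp (step l (step k x)) * rad (step l (step k x)) in mkl m2.
have B0 : 0 < B by lra.
have C0 : 0 < C by lra.
have -> : D2 (lam rho) k l x = rho * ln (E * A / (B * C)).
  have EA0 : 0 < E * A by rewrite mulr_gt0.
  have BC0 : 0 < B * C by rewrite mulr_gt0.
  rewrite (ln_div EA0 BC0) (lnM mkl m0) (lnM B0 C0) /diff2 /lam -/A -/B -/C -/E.
  ring.
rewrite normrM (ger0_norm rho0) (_ : 44 * _ * _ = rho * (44 * delta ^+ 2)); last by ring.
rewrite ler_wpM2l//; set q := _ / _.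
have BC0 : 0 < B * C by rewrite mulr_gt0.
have BC : 1 / 2 * A ^+ 2 <= B * C.
  have : (97 / 100 * A) * (97 / 100 * A) <= B * C by rewrite ler_pM//; lra.
  have : 0 <= A ^+ 2 by rewrite sqr_ge0.
  rewrite expr2; lra.
have dq : `|q - 1| <= 22 * delta ^+ 2.
  rewrite -(ler_pM2r BC0) -[X in `|_| * X](gtr0_norm BC0) -normrM mulrBl mul1r.
  rewrite /q divfK ?gt_eqF// (le_trans m2)//.
  have : 22 * delta ^+ 2 * (1 / 2 * A ^+ 2) <= 22 * delta ^+ 2 * (B * C).
    by rewrite ler_wpM2l// mulr_ge0// sqr_ge0.
  lra.
have dd : delta ^+ 2 <= 1 / 100 * (1 / 100).
  by rewrite expr2 ler_pM ?(ltW d0)//; lra.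
clearbody q; have -> : q = 1 + (q - 1) by ring.
move: (delta ^+ 2) dd dq => e dd dq.
have q2 : `|q - 1| <= 1 / 2 by apply: (le_trans dq); lra.
by apply: (le_trans (ln_norm_le q2)); lra.
Qed.

End Alive.
End LogDamping.

(** * Elementary inequalities between the constants *)

Section Arithmetic.
Variable R : realType.

Lemma sqr_third_le (r q : R) : 0 <= r -> r <= 1 -> r / 8 < q -> (r / 3) ^+ 2 <= q.
Proof. by rewrite expr2; nra. Qed.

Lemma scaled_sqr_le (z r : R) : 0 <= z -> r <= 1 -> 400 * z <= r -> 64 * z ^+ 2 <= r.
Proof. by rewrite expr2; nra. Qed.

Lemma hundred_le (z r s : R) : 0 <= r -> 400 * z <= r -> r / 3 <= s -> 100 * z <= s.
Proof. lra. Qed.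

(** A + d B is the convex combination (1 - d) A + d (A + B) of two nonpositive numbers. In the
    application A and A + B are the second differences of the symmetric and the secret version, and
    d is the value of [damp]. *)
Lemma damped_le (d A B C e : R) : 0 <= d -> d <= 1 -> A <= 0 -> A + B <= 0 ->
  C - d * B <= e -> A + C <= e.
Proof.
move=> d0 d1 A0 AB Ce.
have h1 : d * (A + B) <= 0 by rewrite mulr_ge0_le0.
have h2 : (1 - d) * A <= 0 by rewrite mulr_ge0_le0// subr_ge0.
lra.
Qed.

Lemma absorb_le0 (c rho' A B S e f : R) : 0 <= c -> 2 * c <= 1 -> 0 <= rho' -> 0 <= e ->
  A <= 0 -> B <= e -> S <= - f -> 2 * e <= rho' * f ->
  2 * c * A + 2 * (1 - 2 * c) * B + rho' * S <= 0.
Proof.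
move=> c0 c1 r0 e0 A0 Be Sf ef.
have h1 : c * A <= 0 by rewrite mulr_ge0_le0.
have h2 : rho' * S <= rho' * - f by rewrite ler_wpM2l.
have h3 : (1 - 2 * c) * B <= (1 - 2 * c) * e by rewrite ler_wpM2l// subr_ge0.
have h4 : 0 <= c * e by rewrite mulr_ge0.
lra.
Qed.

Lemma error_ge0 (a b d : R) : 0 <= a -> 0 <= b -> 0 <= d -> 0 <= 4600 * a * b * d.
Proof. by move=> a0 b0 d0; rewrite -!mulrA mulr_ge0 ?ler0n// !mulr_ge0. Qed.

Lemma error_absorb (a b d e f : R) : 0 <= d -> 18400 * a * b <= e * f ->
  2 * (4600 * a * b * d) <= e * (1 / 2 * f * d).
Proof. by move=> d0 h; have := ler_wpM2r d0 h; lra. Qed.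

End Arithmetic.

(** * Submodularity of the damped objective *)

Section LocalSubmodularity.
Variables (R : realType) (zeta eta : R).
Hypothesis eta_gt0 : 0 < eta.
Hypothesis eta_le_zeta : eta <= zeta.

Local Notation du := (du zeta).
Local Notation de := (de eta).
Local Notation ds := (ds eta).
Local Notation step := (add_kind zeta eta).
Local Notation D2 := (diff2 zeta eta).

Lemma step_comm k l x : step l (step k x) = step k (step l x).
Proof. by case: x => m u o p v; rewrite /add_kind /=; congr State; ring. Qed.

Lemma rad_le1 (x : state R) : valid x -> rad x <= 1.
Proof.
move=> vx; have oge := vo0 vx; have o2 := vo2 vx.
have u2 : `|su x| <= 1 / 2 by have := vum vx; have := vu1m vx; lra.
rewrite /rad -[su x ^+ 2]ger0_norm ?sqr_ge0// normrX !expr2.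
have : `|su x| * `|su x| <= 1 / 2 * (1 / 2) by rewrite ler_pM.
have : so x * so x <= 1 / 2 * (1 / 2) by rewrite ler_pM//; lra.
lra.
Qed.

Lemma lam_le1 rho (x : state R) : 0 <= rho -> valid x -> lam rho x <= 1.
Proof.
move=> rho0 vx; rewrite /lam gerDl mulr_ge0_le0// ln_le0//.
by rewrite mulr_ile1 ?rad_le1 ?(vp1 vx) ?(ltW (vp0 vx))// addr_ge0 ?sqr_ge0.
Qed.

Lemma damp_bounds rho (x : state R) : 0 <= rho -> valid x -> 0 <= damp rho x <= 1.
Proof. by move=> rho0 vx; rewrite sqpos_ge0 sqpos_le1// lam_le1. Qed.

Lemma damp_hpart_eq0 rho (x : state R) : 0 < rho -> valid x ->
  sp x * rad x <= expR (- rho^-1) -> damp rho x * hpart x = 0.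
Proof.
move=> rho0 vx h; have p0 := vp0 vx.
have [m0|m0] := ltP 0 (sp x * rad x).
  rewrite /damp sqpos_eq0 ?mul0r// /lam.
  have : ln (sp x * rad x) <= - rho^-1.
    by rewrite -[leRHS]expRK ler_ln ?posrE ?expR_gt0.
  by rewrite -(ler_pM2l rho0) mulrN divff ?gt_eqF// => ?; lra.
(* Here [ln] takes its default value 0, so [damp] is 1; but the state is exactly symmetric and
   [hpart] itself vanishes. *)
have R0 : rad x <= 0 by rewrite -(pmulr_rle0 _ p0).
have [u0 oe0] : su x = 0 /\ so x = 0.
  have : rad x == 0 by rewrite eq_le R0 addr_ge0 ?sqr_ge0.
  by rewrite paddr_eq0 ?sqr_ge0// !sqrf_eq0 => /andP[/eqP ? /eqP ?].
have v1 : sv x = 1.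
  by have := vv0 vx; have := vv1 vx; rewrite oe0 subr0 => ? ?; apply/le_anti/andP.
by rewrite /hpart u0 oe0 v1; ring.
Qed.

Lemma sp_step_le k (x : state R) : valid x -> sp (step k x) <= sp x.
Proof.
move=> vx; rewrite /= ler_piMr ?(ltW (vp0 vx))//.
by rewrite gerBl ds_ge0.
Qed.

Lemma rad_step_le k (x : state R) : rad (step k x) <= 2 * rad x + 2 * zeta ^+ 2.
Proof.
have sq (a b : R) : (a + b) ^+ 2 <= 2 * a ^+ 2 + 2 * b ^+ 2.
  by have := sqr_ge0 (a - b); rewrite !expr2; nra.
have b2 : du k ^+ 2 + de k ^+ 2 <= zeta ^+ 2.
  have : eta ^+ 2 <= zeta ^+ 2.
    by rewrite ler_sqr ?nnegrE ?(ltW eta_gt0) ?(ltW (zeta_gt0 eta_gt0 eta_le_zeta)).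
  by have := sqr_ge0 zeta; case: k => /=; rewrite !expr2 ?mulrNN ?mulr0; lra.
have := sq (su x) (du k); have := sq (so x) (de k).
by rewrite /rad /=; lra.
Qed.

Section Alive.
Variables (x : state R) (k l : kind) (rho r delta : R).
Hypotheses (vx : valid x) (vk : valid (step k x)) (vl : valid (step l x))
  (vkl : valid (step l (step k x))).
Hypotheses (rho_ge0 : 0 <= rho) (rho_le1 : rho <= 1).
Hypotheses (r_gt0 : 0 < r) (r_le1 : r <= 1) (xr : rad x = r ^+ 2).
Hypotheses (zr : zeta = delta * r) (d100 : 100 * delta <= 1).

Let zr' : zeta <= delta * r. Proof. by rewrite zr. Qed.
Let d_gt0 : 0 < delta. Proof. exact: (delta_gt0 eta_gt0 eta_le_zeta r_gt0 zr'). Qed.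

Lemma zeta_le_r : zeta <= r.
Proof.
rewrite zr -[leRHS]mul1r ler_pM2r//.
by have := d100; have := d_gt0; lra.
Qed.

Lemma su_step j (y : state R) s : `|su y| <= s -> `|su (step j y)| <= s + r.
Proof.
move=> us; rewrite (le_trans (ler_normD _ _))// lerD// (norm_du eta_gt0 eta_le_zeta).
have := zeta_le_r; have := r_gt0; case: j => /=; lra.
Qed.

Lemma so_step j (y : state R) s : so y <= s -> so (step j y) <= s + r.
Proof.
move=> us; rewrite lerD//.
have := zeta_le_r; have := r_gt0; have := eta_le_zeta; case: j => /=; lra.
Qed.

Lemma mass_kl_gt0 : 0 < sp (step l (step k x)) * rad (step l (step k x)).
Proof.
have hA := mass_gt0 vx r_gt0 xr.
have hB := mass_step_ge eta_gt0 eta_le_zeta vx r_gt0 r_le1 xr zr' d100 k.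
have hC := mass_step_ge eta_gt0 eta_le_zeta vx r_gt0 r_le1 xr zr' d100 l.
have := mass_D2 eta_gt0 eta_le_zeta vx r_gt0 r_le1 xr zr' d100 k l.
rewrite ler_norml => /andP[h _]; move: h hA hB hC; rewrite /=.
set A := sp x * rad x; set B := _ * rad (step k x); set C := _ * rad (step l x).
set E := _ * rad (step l (step k x)) => h hA hB hC.
rewrite -(pmulr_lgt0 _ hA).
have BC : (97 / 100 * A) * (97 / 100 * A) <= B * C by rewrite ler_pM//; lra.
have A2 : 0 < A ^+ 2 by rewrite exprn_gt0.
have dd : delta ^+ 2 <= 1 / 100 * (1 / 100).
  by rewrite expr2 ler_pM ?(ltW d_gt0)//; have := d100; lra.
have : 11 * delta ^+ 2 * A ^+ 2 <= 11 * (1 / 100 * (1 / 100)) * A ^+ 2.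
  by rewrite ler_wpM2r ?(ltW A2)// ler_wpM2l.
by move: BC A2; rewrite -expr2 exprMn expr2; lra.
Qed.

Lemma damp_step j : valid (step j x) ->
  `|damp rho (step j x) - damp rho x| <= 12 * rho * delta.
Proof.
move=> vj; rewrite /damp (le_trans (@sqpos_lip _ 1 _ _ _ _ _))// ?lam_le1//.
have := lam_step eta_gt0 eta_le_zeta vx r_gt0 r_le1 xr zr' d100 j rho_ge0.
lra.
Qed.

(** A discrete chain rule: the second difference of [lam] enters through the Lipschitz constant 4 of
    [sqpos] below 2, the product of first differences through [sqpos_diff2]. The total is 4 * 44 +
    72. *)
Lemma damp_D2 : `|D2 (damp rho) k l x| <= 248 * rho * delta ^+ 2.
Proof.
have hl := lam_D2 eta_gt0 eta_le_zeta vx r_gt0 r_le1 xr zr' d100 rho_ge0 mass_kl_gt0.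
have a6 := lam_step eta_gt0 eta_le_zeta vx r_gt0 r_le1 xr zr' d100 k rho_ge0.
have b6 := lam_step eta_gt0 eta_le_zeta vx r_gt0 r_le1 xr zr' d100 l rho_ge0.
have l1 := lam_le1 rho_ge0 vl; have l2 := lam_le1 rho_ge0 vkl.
move: hl a6 b6 l1 l2; rewrite /damp /diff2.
set lx := lam rho x; set ll := lam rho (step l x); set lk := lam rho (step k x).
set lkl := lam rho _ => hl a6 b6 l1 l2.
have rd : 6 * rho * delta <= 1.
  have : rho * delta <= 1 * delta by rewrite ler_wpM2r// ltW.
  by have := d100; lra.
have ll2 : lx + (lk - lx) + (ll - lx) <= 2.
  by move: a6; rewrite ler_norml => /andP[_ ?]; lra.
have S1 : `|sqpos lkl - sqpos (lx + (lk - lx) + (ll - lx))| <= 2 * 2 * (44 * rho * delta ^+ 2).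
  apply: (le_trans (@sqpos_lip _ 2 _ _ _ _ _)) => //; first by lra.
  rewrite ler_wpM2l//; move: hl; congr (`| _ | <= _); ring.
have S2 := sqpos_diff2 lx (lk - lx) (ll - lx).
have S3 : 2 * `|lk - lx| * `|ll - lx| <= 72 * rho * delta ^+ 2.
  rewrite -mulrA.
  have : `|lk - lx| * `|ll - lx| <= 6 * rho * delta * (6 * rho * delta) by rewrite ler_pM.
  have : rho * (rho * delta ^+ 2) <= 1 * (rho * delta ^+ 2).
    by rewrite ler_wpM2r// mulr_ge0// sqr_ge0.
  have -> : 6 * rho * delta * (6 * rho * delta) = 36 * (rho * (rho * delta ^+ 2)) by ring.
  lra.
have -> : sqpos lkl - sqpos lk - sqpos ll + sqpos lx =
 (sqpos lkl - sqpos (lx + (lk - lx) + (ll - lx))) +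
 (sqpos (lx + (lk - lx) + (ll - lx)) - sqpos (lx + (lk - lx)) - sqpos (lx + (ll - lx)) + sqpos lx).
  have -> : lx + (lk - lx) = lk by ring.
  have -> : lx + (ll - lx) = ll by ring. ring.
apply: (le_trans (ler_normD _ _)); lra.
Qed.

(* Leibniz rule: apart from [damp x * D2 hpart], only terms containing a
   difference of [damp] remain, and each of these carries a factor [rho]. *)
Lemma cross_error :
  D2 (fun y => damp rho y * hpart y) k l x - damp rho x * D2 (@hpart R) k l x
  <= 4600 * rho * zeta ^+ 2 * sp x.
Proof.
have u0 := su_le_r r_gt0 xr; have oe0 := so_le_r vx r_gt0 xr.
have p0 := vp0 vx.
have uk := su_step k u0; have ul := su_step l u0.
have ok := so_step k oe0; have ol := so_step l oe0.
have ukl := su_step l uk; have okl := so_step l ok.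
have z0 : 0 < zeta := zeta_gt0 eta_gt0 eta_le_zeta.
have pk := sp_step_le k vx; have pl := sp_step_le l vx.
have pkl : sp (step l (step k x)) <= sp x := le_trans (sp_step_le l vk) pk.
have Hkl : `|hpart (step l (step k x))| <= 18 * sp x * r ^+ 2.
  apply: (le_trans (hpart_bound vkl ukl okl)).
  have -> : r + r + r = 3 * r by ring.
  have : sp (step l (step k x)) * r ^+ 2 <= sp x * r ^+ 2.
    by rewrite ler_wpM2r// sqr_ge0.
  rewrite exprMn; lra.
have Hk : `|hpart (step l (step k x)) - hpart (step k x)| <= 4 * zeta * sp x * r.
  apply: (le_trans (hpart_step eta_gt0 eta_le_zeta l vk uk ok)).
  have : zeta * r * sp (step k x) <= zeta * r * sp x by rewrite ler_wpM2l// mulr_ge0 ?ltW.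
  lra.
have Hl : `|hpart (step l (step k x)) - hpart (step l x)| <= 4 * zeta * sp x * r.
  rewrite step_comm.
  apply: (le_trans (hpart_step eta_gt0 eta_le_zeta k vl ul ol)).
  have : zeta * r * sp (step l x) <= zeta * r * sp x by rewrite ler_wpM2l// mulr_ge0 ?ltW.
  lra.
have Mk := damp_step vk; have Ml := damp_step vl; have M2 := damp_D2.
apply: (le_trans (ler_norm _)).
have -> : D2 (fun y => damp rho y * hpart y) k l x - damp rho x * D2 (@hpart R) k l x =
  (damp rho (step k x) - damp rho x) * (hpart (step l (step k x)) - hpart (step k x))
  + (damp rho (step l x) - damp rho x) * (hpart (step l (step k x)) - hpart (step l x))
  + D2 (damp rho) k l x * hpart (step l (step k x)).
  rewrite /diff2; ring.
have T1 : `|(damp rho (step k x) - damp rho x) * (hpart (step l (step k x)) - hpart (step k x))|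
   <= 12 * rho * delta * (4 * zeta * sp x * r) by rewrite normrM ler_pM.
have T2 : `|(damp rho (step l x) - damp rho x) * (hpart (step l (step k x)) - hpart (step l x))|
   <= 12 * rho * delta * (4 * zeta * sp x * r) by rewrite normrM ler_pM.
have T3 : `|D2 (damp rho) k l x * hpart (step l (step k x))|
   <= 248 * rho * delta ^+ 2 * (18 * sp x * r ^+ 2) by rewrite normrM ler_pM.
apply: (le_trans (ler_normD _ _)).
apply: (@le_trans _ _ (12 * rho * delta * (4 * zeta * sp x * r) +
   12 * rho * delta * (4 * zeta * sp x * r) +
   248 * rho * delta ^+ 2 * (18 * sp x * r ^+ 2))).
  by rewrite lerD// (le_trans (ler_normD _ _))// lerD.
(* Since [zeta = delta * r], the powers of [r] cancel; the sum 48 + 48 + 4464 stays below 4600. *)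
have -> : 12 * rho * delta * (4 * zeta * sp x * r) = 48 * (rho * zeta ^+ 2 * sp x).
  rewrite zr; ring.
have -> : 248 * rho * delta ^+ 2 * (18 * sp x * r ^+ 2) = 4464 * (rho * zeta ^+ 2 * sp x).
  rewrite zr; ring.
have -> : 4600 * rho * zeta ^+ 2 * sp x = 4600 * (rho * zeta ^+ 2 * sp x) by ring.
have : 0 <= rho * zeta ^+ 2 * sp x by rewrite !mulr_ge0 ?sqr_ge0// ltW.
lra.
Qed.

End Alive.

(** Two steps raise [rad] to at most [4 * rad x + 6 * zeta ^+ 2] and do not raise [sp]. As 4/8 +
    6/64 < 1, all four corners stay below the threshold where the damped term is zero. *)
Lemma smooth_D2_dead (rho : R) k l (x : state R) : 0 < rho ->
  valid x -> valid (step k x) -> valid (step l x) -> valid (step l (step k x)) ->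
  64 * zeta ^+ 2 <= expR (- rho^-1) -> sp x * rad x <= expR (- rho^-1) / 8 ->
  D2 (fun y => damp rho y * hpart y) k l x = 0.
Proof.
move=> rho0 vx vk vl vkl zz dead; have z2 := sqr_ge0 zeta.
have deadP (y : state R) : valid y -> sp y <= sp x ->
    rad y <= 4 * rad x + 6 * zeta ^+ 2 -> damp rho y * hpart y = 0.
  move=> vy py ry; apply: damp_hpart_eq0 => //.
  have h1 : sp y * rad y <= sp x * (4 * rad x + 6 * zeta ^+ 2).
    by rewrite ler_pM ?(ltW (vp0 vy))// addr_ge0 ?sqr_ge0.
  have h2 : sp x * zeta ^+ 2 <= 1 * zeta ^+ 2 by rewrite ler_wpM2r ?(vp1 vx).
  apply: (le_trans h1); move: h2 dead zz (expR_ge0 (- rho^-1)); clear; lra.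
have R0 : 0 <= rad x by rewrite addr_ge0 ?sqr_ge0.
have pk := sp_step_le k vx; have pl := sp_step_le l vx.
have pkl := le_trans (sp_step_le l vk) pk.
have rk := rad_step_le k x; have rl := rad_step_le l x.
have rkl := rad_step_le l (step k x).
rewrite /diff2 (deadP _ vx) ?(deadP _ vk) ?(deadP _ vl) ?(deadP _ vkl)//;
  first by rewrite !subr0 addr0.
- by apply: (le_trans rkl); lra.
- by apply: (le_trans rl); lra.
- by apply: (le_trans rk); lra.
- by lra.
Qed.

Lemma smooth_D2_alive (rho : R) k l (x : state R) : 0 < rho -> rho <= 1 ->
  valid x -> valid (step k x) -> valid (step l x) -> valid (step l (step k x)) ->
  400 * zeta <= expR (- rho^-1) -> expR (- rho^-1) / 8 < sp x * rad x ->
  D2 (fun y => damp rho y * hpart y) k l x - damp rho x * D2 (@hpart R) k l x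
  <= 4600 * rho * zeta ^+ 2 * sp x.
Proof.
set r1 := expR _ => rho0 rho1 vx vk vl vkl zsmall alive.
have r1gt : 0 < r1 by rewrite expR_gt0.
have r1le : r1 <= 1 by rewrite expR_le1 oppr_le0 invr_ge0 ltW.
clearbody r1.
have R1 : r1 / 8 < rad x.
  apply: (lt_le_trans alive); rewrite ler_piMl ?(vp1 vx)//.
  by rewrite addr_ge0 ?sqr_ge0.
have R0 : 0 < rad x by apply: lt_trans R1; rewrite divr_gt0.
pose r := Num.sqrt (rad x).
have r0 : 0 < r by rewrite sqrtr_gt0.
have xr : rad x = r ^+ 2 by rewrite sqr_sqrtr// ltW.
have rle : r <= 1.
  by rewrite -ler_sqr ?nnegrE ?(ltW r0)// expr1n -xr rad_le1.
(* From [rad x > r1 / 8] and [r1 <= 1] the distance [r] is at least [r1 / 3], so a step is small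
   relative to [r]. *)
have rge : 100 * zeta <= r.
  have r13 : r1 / 3 <= r.
    rewrite -ler_sqr ?nnegrE ?(ltW r0) ?divr_ge0 ?(ltW r1gt)// -xr.
    exact: (sqr_third_le (ltW r1gt) r1le R1).
  exact: (hundred_le (ltW r1gt) zsmall r13).
have zr : zeta = zeta / r * r by rewrite divfK ?gt_eqF.
have d100 : 100 * (zeta / r) <= 1 by rewrite mulrA ler_pdivrMr// mul1r.
exact: (@cross_error x k l rho r (zeta / r) vx vk vl vkl (ltW rho0) rho1 r0 rle xr zr d100).
Qed.

Lemma smooth_D2 (rho : R) k l (x : state R) : 0 < rho -> rho <= 1 ->
  valid x -> valid (step k x) -> valid (step l x) -> valid (step l (step k x)) ->
  400 * zeta <= expR (- rho^-1) ->
  D2 (@gsym R) k l x + D2 (fun y => damp rho y * hpart y) k l x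
  <= 4600 * rho * zeta ^+ 2 * sp x.
Proof.
move=> rho0 rho1 vx vk vl vkl zsmall.
have hg := gsym_D2_le0 eta_gt0 eta_le_zeta vx k l.
have [dead|alive] := leP (sp x * rad x) (expR (- rho^-1) / 8).
  rewrite smooth_D2_dead// ?addr0; last first.
    apply: scaled_sqr_le zsmall; first exact: ltW (zeta_gt0 eta_gt0 eta_le_zeta).
    by rewrite expR_le1 oppr_le0 invr_ge0 ltW.
  exact: (le_trans hg (error_ge0 (ltW rho0) (sqr_ge0 zeta) (ltW (vp0 vx)))).
have hf := fhid_D2_le0 eta_gt0 eta_le_zeta vx k l.
have /andP[d0 d1] := damp_bounds (ltW rho0) vx.
have E : D2 (fun y => gsym y + hpart y) k l x =
  D2 (@gsym R) k l x + D2 (@hpart R) k l x by rewrite /diff2; ring.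
rewrite E in hf.
exact: (damped_le d0 d1 hg hf (smooth_D2_alive rho0 rho1 vx vk vl vkl zsmall alive)).
Qed.

(** At the planted optimum the cut term is about c and the coverage term about 1 - 2 c. At a
    symmetric set with coverage c and [sm] = m the first two terms give 2 c (1 - m) (m + 1 - 2 c),
    which is maximal at m = c. *)
Definition hard (c rho rho' eps : R) (x : state R) :=
  2 * c * cut eps x + 2 * (1 - 2 * c) * (gsym x + damp rho x * hpart x)
  + rho' * slack x.

Lemma hard_D2 (c rho rho' eps : R) k l (x : state R) :
  0 <= c -> 2 * c <= 1 -> 0 < rho -> rho <= 1 -> 0 <= rho' ->
  400 * zeta <= expR (- rho^-1) ->
  18400 * rho * zeta ^+ 2 <= rho' * eta ^+ 2 ->
  valid x -> valid (step k x) -> valid (step l x) -> valid (step l (step k x)) ->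
  D2 (hard c rho rho' eps) k l x <= 0.
Proof.
move=> c0 c1 rho0 rho1 rho'0 zsmall slk vx vk vl vkl.
have hc := cut_D2_le0 eta_gt0 eta_le_zeta x eps k l.
have hs := slack_D2_le eta_gt0 eta_le_zeta vx k l.
have hm := smooth_D2 rho0 rho1 vx vk vl vkl zsmall.
have -> : D2 (hard c rho rho' eps) k l x =
  2 * c * D2 (cut eps) k l x + 2 * (1 - 2 * c) *
   (D2 (@gsym R) k l x + D2 (fun y => damp rho y * hpart y) k l x)
  + rho' * D2 (@slack R) k l x.
  rewrite /diff2 /hard; ring.
have p0 := ltW (vp0 vx).
apply: (absorb_le0 c0 c1 rho'0 _ hc hm hs).
  exact: (error_ge0 (ltW rho0) (sqr_ge0 zeta) p0).
exact: (error_absorb p0 slk).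
Qed.

End LocalSubmodularity.

(** * The hidden instances *)

(** Nonpositive second differences suffice: the elements of [T :\: S] are removed one at a time and
    the inequalities telescope. *)
Lemma submodular_local (R : realType) n (f : {set 'I_n} -> R) :
  (forall (S : {set 'I_n}) x y, x != y -> x \notin S -> y \notin S ->
     f (y |: (x |: S)) - f (x |: S) - f (y |: S) + f S <= 0) ->
  submodular f.
Proof.
move=> loc S T u ST; have [k] := ubnP #|T :\: S|.
elim: k T ST => // k IH T ST leTk uT.
have [TS|/subsetPn[y yT yS]] := boolP (T \subset S).
  by have -> : T = S by apply/eqP; rewrite finset.eqEsubset TS.
have ST' : S \subset T :\ y by rewrite finset.subsetD1 ST yS.
have uT' : u \notin T :\ y by rewrite !inE negb_and uT orbT.
have uy : u != y by apply: contraNneq uT => ->.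
have yT' : y \notin T :\ y by rewrite !inE eqxx.
have card : (#|(T :\ y) :\: S| < k)%N.
  rewrite -ltnS (leq_trans _ leTk)// ltnS.
  have -> : (T :\ y) :\: S = (T :\: S) :\ y by apply/setP => z; rewrite !inE; case: eqP => //=; rewrite andbF.
  by rewrite (cardsD1 y (T :\: S)) !inE yS yT.
have := IH _ ST' card uT'; have := loc (T :\ y) y u.
rewrite eq_sym uy => /(_ isT yT' uT'); rewrite finset.setD1K//.
by lra.
Qed.

Section Instance.
Variables (R : realType) (d b N : nat).

Definition elt : finType := (('I_d * bool) + ('I_b * 'I_N))%type.
Definition secret : finType := ({ffun 'I_d -> bool} * {ffun 'I_b -> 'I_N})%type.

(** Normalized so that one point from every pair has total weight 1/2 in [sm]; likewise one point
    from every block has total [block_weight] 1/2. *)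
Definition pair_weight : R := (2 * d%:R)^-1.
Definition block_weight : R := (2 * b%:R)^-1.
Local Notation zeta := pair_weight.
Local Notation eta := block_weight.

Definition kindof (C : secret) (z : elt) : kind :=
  match z with
  | inl it => if it.2 == C.1 it.1 then KA else KB
  | inr ic => if ic.2 == C.2 ic.1 then KO else KS
  end.

Definition stateof (C : secret) (S : {set elt}) : state R :=
  State (\sum_(z in S) dm zeta (kindof C z)) (\sum_(z in S) du zeta (kindof C z))
    (\sum_(z in S) de eta (kindof C z)) (\prod_(z in S) (1 - ds eta (kindof C z)))
    (\prod_(z in S) (1 - de eta (kindof C z))).

Lemma stateofU1 C z (S : {set elt}) : z \notin S ->
  stateof C (z |: S) = add_kind zeta eta (kindof C z) (stateof C S).
Proof.
move=> zS; rewrite /stateof /add_kind /=; congr State; rewrite big_setU1//=;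
  first [exact: addrC | exact: mulrC].
Qed.

Hypotheses (d_gt0 : (0 < d)%N) (d_le_b : (d <= b)%N).

Lemma b_gt0 : (0 < b)%N. Proof. exact: leq_trans d_le_b. Qed.

Lemma eta_gt0 : 0 < eta.
Proof. by rewrite invr_gt0 mulr_gt0// ltr0n b_gt0. Qed.

Lemma eta_le_zeta : eta <= zeta.
Proof.
rewrite lef_pV2 ?posrE ?mulr_gt0 ?ltr0n ?b_gt0//.
by rewrite ler_pM2l// ler_nat.
Qed.

Lemma eta_le1 : 2 * eta <= 1.
Proof.
by rewrite /block_weight invfM mulrA divff// mul1r invf_le1 ?ler1n ?ltr0n b_gt0.
Qed.

Lemma sum_le_setT (w : elt -> R) (S : {set elt}) : (forall z, 0 <= w z) ->
  \sum_(z in S) w z <= \sum_z w z.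
Proof.
by move=> w0; rewrite [leRHS](bigID (mem S))/= lerDl sumr_ge0.
Qed.

Lemma sum_elt (w : elt -> R) :
  \sum_z w z = \sum_i \sum_t w (inl (i, t)) + \sum_i \sum_t w (inr (i, t)).
Proof.
rewrite big_sumType/= !pair_bigA/=.
by congr (_ + _); apply: eq_bigr => -[].
Qed.

Lemma sum_pick (I : finType) (i0 : I) (x : R) :
  \sum_(i : I) (if i == i0 then x else 0) = x.
Proof. by rewrite -big_mkcond big_pred1_eq. Qed.

Lemma zeta_d : \sum_(i < d) (2 * zeta) = 1.
Proof.
rewrite sumr_const card_ord -[LHS]mulr_natr /pair_weight mulrAC divff//.
by rewrite mulf_neq0// pnatr_eq0 -lt0n.
Qed.

Lemma eta_b : \sum_(i < b) eta = 1 / 2.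
Proof.
rewrite sumr_const card_ord -[LHS]mulr_natr /block_weight invfM -mulrA mulVf ?div1r ?mulr1//.
by rewrite pnatr_eq0 -lt0n b_gt0.
Qed.

Lemma stateof_valid C (S : {set elt}) : valid (stateof C S).
Proof.
have e0 := eta_gt0; have ez := eta_le_zeta; have e1 := eta_le1.
have vS : let so := \sum_(z in S) de eta (kindof C z) in
  let v := \prod_(z in S) (1 - de eta (kindof C z)) in
  [/\ 0 <= so, 1 - so <= v, v <= 1, 0 <= v & v <= 1 - so + so ^+ 2].
  rewrite /=; apply: (big_rec2 (fun so v : R =>
    [/\ 0 <= so, 1 - so <= v, v <= 1, 0 <= v & v <= 1 - so + so ^+ 2])).
    by split; rewrite ?expr2; lra.
  move=> z v so _ [h1 h2 h3 h5 h4].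
  have : 0 <= de eta (kindof C z) <= 1 by case: (kindof C z) => /=; lra.
  move: (de _ _) => e /andP[e2 e3]; split; rewrite ?expr2 in h4 *; nra.
have pS : 0 < \prod_(z in S) (1 - ds eta (kindof C z)) <= 1.
  apply: (big_ind (fun x : R => 0 < x <= 1)); first by lra.
    by move=> x y /andP[? ?] /andP[? ?]; rewrite mulr_gt0//= mulr_ile1// ltW.
  by move=> z _; case: (kindof C z) => /=; lra.
have dA z : 0 <= dm zeta z + du zeta z.
  by have := zeta_gt0 e0 ez; case: z => /=; lra.
have dB z : 0 <= dm zeta z - du zeta z.
  by have := zeta_gt0 e0 ez; case: z => /=; lra.
(* [sm + su] sums nonnegative weights carried by one point [2 * zeta] per pair; [sm - su] is treated
   in the same way with the other points. *)
have sA : \sum_(z in S) (dm zeta (kindof C z) + du zeta (kindof C z)) <= 1.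
  apply: (le_trans (sum_le_setT _ (fun z => dA _))).
  rewrite sum_elt [X in _ + X]big1 ?addr0; last first.
    by move=> i _; rewrite big1// => t _ /=; case: ifP => _ /=; lra.
  rewrite -zeta_d; apply: ler_sum => i _.
  rewrite (eq_bigr (fun t => if t == C.1 i then 2 * zeta else 0)) ?sum_pick//.
  by move=> t _ /=; case: ifP => _ /=; lra.
have sB : \sum_(z in S) (dm zeta (kindof C z) - du zeta (kindof C z)) <= 1.
  apply: (le_trans (sum_le_setT _ (fun z => dB _))).
  rewrite sum_elt [X in _ + X]big1 ?addr0; last first.
    by move=> i _; rewrite big1// => t _ /=; case: ifP => _ /=; lra.
  rewrite -zeta_d; apply: ler_sum => i _.
  rewrite (eq_bigr (fun t => if t == ~~ C.1 i then 2 * zeta else 0)) ?sum_pick//.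
  by move=> t _ /=; case: (C.1 i); case: t => /=; lra.
have sO : \sum_(z in S) de eta (kindof C z) <= 1 / 2.
  apply: (le_trans (sum_le_setT _ _)).
    by move=> z; rewrite de_ge0.
  rewrite sum_elt [X in X + _]big1 ?add0r; last first.
    by move=> i _; rewrite big1// => t _ /=; case: ifP.
  rewrite -eta_b; apply: ler_sum => i _.
  rewrite (eq_bigr (fun t => if t == C.2 i then eta else 0)) ?sum_pick//.
  by move=> t _ /=; case: ifP.
have /andP[p0 p1] := pS; have [h1 h2 h3 h5 h4] := vS.
rewrite big_split/= in sA; rewrite big_split/= sumrN in sB.
split => //=.
- apply: (le_trans (ler_norm_sum _ _ _)); apply: ler_sum => z _.
  by rewrite (norm_du e0 ez).
- by rewrite ler_norml; apply/andP; split; lra.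
- lra.
Qed.

End Instance.

Section Pullback.
Variables (R : realType) (d b N n : nat) (iota : elt d b N -> 'I_n).
Hypothesis iota_inj : injective iota.
Hypotheses (d_gt0 : (0 < d)%N) (d_le_b : (d <= b)%N).

(** Elements outside the image of [iota] are dummies, so that a ground set of any large enough size
    can carry an instance. *)
Definition pull (F : state R -> R) (C : secret d b N) (S : {set 'I_n}) : R :=
  F (stateof R C (iota @^-1: S)).

Lemma pull_nonneg F C : (forall x, valid x -> 0 <= F x) -> nonneg_fun (pull F C).
Proof. by move=> F0 S; apply: F0; apply: stateof_valid. Qed.

Lemma preim_inU1 z (S : {set 'I_n}) : iota @^-1: (iota z |: S) = z |: iota @^-1: S.
Proof. by apply/setP => t; rewrite !inE (inj_eq iota_inj). Qed.

Lemma preim_outU1 x (S : {set 'I_n}) : x \notin codom iota ->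
  iota @^-1: (x |: S) = iota @^-1: S.
Proof.
move=> xi; apply/setP => t; rewrite !inE; case: eqP => // xt.
by rewrite -xt codom_f in xi.
Qed.

Lemma pull_submodular (F : state R -> R) C :
  (forall k l x, valid x -> valid (add_kind (pair_weight R d) (block_weight R b) k x) ->
     valid (add_kind (pair_weight R d) (block_weight R b) l x) ->
     valid (add_kind (pair_weight R d) (block_weight R b) l (add_kind (pair_weight R d) (block_weight R b) k x)) ->
     diff2 (pair_weight R d) (block_weight R b) F k l x <= 0) ->
  submodular (pull F C).
Proof.
move=> FD2; apply: submodular_local => S x y xy xS yS; rewrite /pull.
have [xi|xi] := boolP (x \in codom iota); last first.
  have [yi|yi] := boolP (y \in codom iota).
    case/codomP: yi xy yS => z -> xy yS.
    by rewrite !preim_inU1 !preim_outU1//; lra.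
  by rewrite !preim_outU1//; lra.
have [yi|yi] := boolP (y \in codom iota); last first.
  by rewrite !(preim_outU1 _ yi); lra.
case/codomP: xi xy xS => u ->; case/codomP: yi yS => v -> vS uv uS.
rewrite !preim_inU1; set Q := _ @^-1: S.
have uQ : u \notin Q by rewrite inE.
have vQ : v \notin Q by rewrite inE.
have vuQ : v \notin u |: Q.
  by rewrite !inE negb_or vS andbT eq_sym -(inj_eq iota_inj).
have vQv := stateof_valid R d_gt0 d_le_b C.
have := FD2 (kindof C u) (kindof C v) (stateof R C Q) (vQv Q).
rewrite /diff2 -!stateofU1//; apply; exact: vQv.
Qed.

End Pullback.

(** * Concealment of the secret *)

Section Chernoff.
Variable R : realType.

(** The exponential Markov inequality in counting form: for a uniformly random function the values
    are independent, so the sum of exponentials factors over [I]. *)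
Lemma chernoff_count (I J : finType) (g : I -> J -> R) (kap : I -> R) (a : R) :
  (forall i, \sum_j expR (g i j) <= #|J|%:R * expR (kap i)) ->
  #|[set F : {ffun I -> J} | a <= \sum_i g i (F i)]|%:R
  <= #|J|%:R ^+ #|I| * expR (\sum_i kap i - a).
Proof.
move=> mgf; rewrite expRB mulrA ler_pdivlMr ?expR_gt0//.
apply: (@le_trans _ _ (\sum_(F : {ffun I -> J}) expR (\sum_i g i (F i)))).
  rewrite -sum1_card natr_sum mulr_suml.
  rewrite (eq_bigl (fun F : {ffun I -> J} => a <= \sum_i g i (F i))); last by move=> F; rewrite inE.
  rewrite [leRHS](bigID (fun F : {ffun I -> J} => a <= \sum_i g i (F i)))/=.
  rewrite -[leLHS]addr0 lerD//; last by apply: sumr_ge0 => F _; exact: expR_ge0.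
  by apply: ler_sum => F aF; rewrite mul1r ler_expR.
under eq_bigr do rewrite expR_sum.
rewrite -(bigA_distr_bigA (fun i j => expR (g i j))) expR_sum.
rewrite -prodr_const -big_split/=; apply: ler_prod => i _.
by rewrite mgf andbT sumr_ge0// => j _; exact: expR_ge0.
Qed.

(** From e^x <= 1/(1 - x) and its mirror image the sum is at most 2/(1 - x^2), which is at most 2 (1
    + 2 x^2) in this range. *)
Lemma expR_pair_le (x : R) : `|x| <= 1 / 2 -> expR x + expR (- x) <= 2 * expR (2 * x ^+ 2).
Proof.
move=> /ler_normlP[x1 x2].
have h1 : expR x * (1 - x) <= 1.
  by have := ler_wpM2l (expR_ge0 x) (expR_ge1Dx (- x)); rewrite -expRD subrr expR0.
have h2 : expR (- x) * (1 + x) <= 1.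
  by have := ler_wpM2l (expR_ge0 (- x)) (expR_ge1Dx x); rewrite -expRD addNr expR0.
have h3 : 1 + 2 * x ^+ 2 <= expR (2 * x ^+ 2) by exact: expR_ge1Dx.
have q : 0 < 1 - x ^+ 2 by nra.
rewrite -(ler_pM2r q).
have h4 : (expR x + expR (- x)) * (1 - x ^+ 2) <= 2.
  have : expR x * (1 - x) * (1 + x) <= 1 * (1 + x) by rewrite ler_wpM2r//; lra.
  have : expR (- x) * (1 + x) * (1 - x) <= 1 * (1 - x) by rewrite ler_wpM2r//; lra.
  by rewrite expr2; nra.
apply: (le_trans h4).
have : (1 + 2 * x ^+ 2) * (1 - x ^+ 2) <= expR (2 * x ^+ 2) * (1 - x ^+ 2).
  by rewrite ler_wpM2r// ltW.
have : 1 <= (1 + 2 * x ^+ 2) * (1 - x ^+ 2).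
  have : x ^+ 2 <= 1 / 2 by rewrite expr2; nra.
  by move: (x ^+ 2) (sqr_ge0 x) => y y0 y1; nra.
lra.
Qed.

Lemma expR1_le4 : expR 1 <= 4 :> R.
Proof.
have h : expR (2^-1 : R) <= 2.
  have := expR_ge1Dx (- 2^-1 : R); rewrite expRN => h.
  have h2 : (2^-1 : R) <= (expR (2^-1 : R))^-1 by lra.
  by rewrite -lef_pV2 ?posrE ?expR_gt0.
have -> : (1 : R) = 2^-1 + 2^-1 by lra.
rewrite expRD; have := expR_ge0 (2^-1 : R); nra.
Qed.

End Chernoff.

Lemma card_fst (A B : finType) (P : pred A) :
  #|[set C : A * B | P C.1]| = (#|[set a | P a]| * #|B|)%N.
Proof.
rewrite -cardsT -cardsX; apply: eq_card => -[a c].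
by rewrite !inE andbT.
Qed.

Lemma card_snd (A B : finType) (P : pred B) :
  #|[set C : A * B | P C.2]| = (#|A| * #|[set a | P a]|)%N.
Proof.
rewrite -cardsT -cardsX; apply: eq_card => -[a c].
by rewrite !inE.
Qed.

Section Concealment.
Variables (R : realType) (d b N : nat).
Hypotheses (d_gt0 : (0 < d)%N) (d_le_b : (d <= b)%N) (N_gt0 : (0 < N)%N).

Local Notation elt := (elt d b N).
Local Notation secret := (secret d b N).
Local Notation zeta := (pair_weight R d).
Local Notation eta := (block_weight R b).

(** What remains of [hard] without the truncated square and the hidden part. It depends on the state
    only through [sm] and [sp * sv], which are the same for all secrets. *)
Definition soft (c rho' : R) (x : state R) :=
  2 * c * (sm x * (1 - sm x)) + 2 * (1 - 2 * c) * gsym x + rho' * slack x.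

Lemma sm_indep (C C' : secret) (S : {set elt}) : sm (stateof R C S) = sm (stateof R C' S).
Proof.
by apply: eq_bigr => -[[i t]|[i t]] _ /=; case: ifP => _; case: ifP.
Qed.

Lemma spv_indep (C C' : secret) (S : {set elt}) : sp (stateof R C S) * sv (stateof R C S) =
  sp (stateof R C' S) * sv (stateof R C' S).
Proof.
rewrite /= -!big_split/=.
by apply: eq_bigr => -[[i t]|[i t]] _ /=; case: ifP => _; case: ifP => _;
  rewrite /= ?(subr0, mulr1, mul1r).
Qed.

Lemma soft_indep c rho' (C C' : secret) (S : {set elt}) :
  soft c rho' (stateof R C S) = soft c rho' (stateof R C' S).
Proof. by rewrite /soft /gsym /slack (spv_indep C C') (sm_indep C C'). Qed.

Definition load (S : {set elt}) : R := \sum_i (\sum_(t : 'I_N | inr (i, t) \in S) 1).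

Lemma sum_mem (w : elt -> R) (S : {set elt}) :
  \sum_(z in S) w z = \sum_i \sum_(t | inl (i, t) \in S) w (inl (i, t))
                    + \sum_i \sum_(t | inr (i, t) \in S) w (inr (i, t)).
Proof.
rewrite big_mkcond sum_elt; congr (_ + _); apply: eq_bigr => i _;
  by rewrite [RHS]big_mkcond.
Qed.

Lemma load_sum (C : secret) (S : {set elt}) :
  \sum_(z in S) ds eta (kindof C z) + so (stateof R C S) = eta * load S.
Proof.
rewrite /= -big_split /= sum_mem [X in X + _]big1 ?add0r; last first.
  by move=> i _; rewrite big1// => t _ /=; case: ifP => _ /=; rewrite addr0.
rewrite /load mulr_sumr; apply: eq_bigr => i _; rewrite mulr_sumr.
by apply: eq_bigr => t _ /=; case: ifP => _ /=; rewrite ?addr0 ?add0r mulr1.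
Qed.

Lemma sp_le_load (C : secret) (S : {set elt}) : sp (stateof R C S) <= expR (1 / 2 - eta * load S).
Proof.
have vS := stateof_valid R d_gt0 d_le_b C S; have e1 := eta_le1 R d_gt0 d_le_b.
have e0 := eta_gt0 R d_gt0 d_le_b.
rewrite -(load_sum C).
apply: (@le_trans _ _ (expR (- \sum_(z in S) ds eta (kindof C z)))).
  rewrite -sumrN expR_sum /=; apply: ler_prod => z _.
  rewrite expR_ge1Dx andbT subr_ge0; case: (kindof C z) => //=; lra.
by rewrite ler_expR; have := vo2 vS; lra.
Qed.

(** The damped term vanishes once [sp * rad <= 5 * eps]. Either [rad <= eps ^+ 2 + (2 * eps) ^+ 2 <=
    5 * eps], or the load is so large that [sp] alone is below the threshold. *)
Lemma hard_eq_soft c rho rho' eps (C : secret) (S : {set elt}) : 0 < rho ->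
  5 * eps = expR (- rho^-1) -> `|su (stateof R C S)| <= eps ->
  (so (stateof R C S) <= 2 * eps \/ rho^-1 + 1 / 2 <= eta * load S) ->
  hard c rho rho' eps (stateof R C S) = soft c rho' (stateof R C S).
Proof.
move=> rho0 epsE ule disj; have vS := stateof_valid R d_gt0 d_le_b C S.
rewrite /hard /soft damp_hpart_eq0 ?addr0//.
  congr (2 * c * _ + _ + _); rewrite /cut sqpos_eq0 ?addr0// subr_le0.
  by rewrite (le_trans _ ule)// ler_norm.
have r0 : 0 < expR (- rho^-1) by rewrite expR_gt0.
have r1 : expR (- rho^-1) <= 1 by rewrite expR_le1 oppr_le0 invr_ge0 ltW.
have R0 : 0 <= rad (stateof R C S) by rewrite addr_ge0 ?sqr_ge0.
case: disj => [ole|le].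
  apply: (@le_trans _ _ (rad (stateof R C S))).
    by rewrite ler_piMl ?(vp1 vS).
  rewrite /rad -[su _ ^+ 2]ger0_norm ?sqr_ge0// normrX.
  have e0 : 0 < eps by move: r0; rewrite -epsE pmulr_rgt0.
  have h1 : `|su (stateof R C S)| ^+ 2 <= eps ^+ 2.
    by rewrite ler_sqr ?nnegrE ?normr_ge0 ?(ltW e0).
  have h2 : so (stateof R C S) ^+ 2 <= (2 * eps) ^+ 2.
    by rewrite ler_sqr ?nnegrE ?(vo0 vS) ?mulr_ge0 ?(ltW e0).
  have h3 : eps * eps <= eps * 1 by rewrite ler_wpM2l ?(ltW e0)//; lra.
  apply: (le_trans (lerD h1 h2)); rewrite -epsE exprMn !expr2; lra.
apply: (@le_trans _ _ (sp (stateof R C S))).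
  by rewrite ler_piMr ?(rad_le1 vS)// ltW// (vp0 vS).
apply: (le_trans (sp_le_load C S)); rewrite ler_expR; lra.
Qed.

Definition side (S : {set elt}) (i : 'I_d) (s : bool) : R :=
  \sum_(t | inl (i, t) \in S) (if t == s then 1 else -1).

Lemma su_side (C : secret) (S : {set elt}) :
  su (stateof R C S) = zeta * \sum_i side S i (C.1 i).
Proof.
rewrite /= sum_mem [X in _ + X]big1 ?addr0; last first.
  by move=> i _; rewrite big1// => t _ /=; case: ifP.
rewrite mulr_sumr; apply: eq_bigr => i _; rewrite /side mulr_sumr.
by apply: eq_bigr => t _ /=; case: ifP => _ /=; rewrite ?mulr1 ?mulrN1.
Qed.

Lemma side_cases (S : {set elt}) i :
  exists2 w : R, `|w| <= 1 & side S i true = w /\ side S i false = - w.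
Proof.
exists (side S i true); rewrite /side !(big_mkcond (fun t => inl (i, t) \in S)) /=.
  by rewrite big_bool /=; do 2 case: ifP => _; rewrite ler_norml; apply/andP; split; lra.
by split=> //; rewrite !big_bool /=; do 2 case: ifP => _; lra.
Qed.

(** Over the secrets, each pair contributes a symmetric variable with values in [-1,1]. The two
    signs of [lam] serve the two tails of [su]. *)
Lemma card_su_gt (S : {set elt}) (eps lam : R) : 0 < eps -> eps <= 1 -> `|lam| = eps / 2 ->
  #|[set F : {ffun 'I_d -> bool} | eps ^+ 2 * d%:R <= \sum_i lam * side S i (F i)]|%:R
  <= 2 ^+ d * expR (- (eps ^+ 2 * d%:R / 2)).
Proof.
move=> e0 e1 le.
have := @chernoff_count R 'I_d bool (fun i s => lam * side S i s)
  (fun=> eps ^+ 2 / 2) (eps ^+ 2 * d%:R).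
rewrite card_ord card_bool sumr_const card_ord.
rewrite (_ : (eps ^+ 2 / 2) *+ d - eps ^+ 2 * d%:R = - (eps ^+ 2 * d%:R / 2)); last first.
  by rewrite -[(_ / _) *+ d]mulr_natr; lra.
apply=> i; rewrite big_bool /=; have [w w1 [-> ->]] := side_cases S i.
rewrite mulrN; apply: (le_trans (expR_pair_le _)).
  rewrite normrM le.
  have : eps / 2 * `|w| <= eps / 2 * 1 by rewrite ler_wpM2l// divr_ge0 ?ltW.
  lra.
rewrite ler_pM2l// ler_expR -(ger0_norm (sqr_ge0 (lam * w))) normrX normrM le.
rewrite exprMn.
have : `|w| ^+ 2 <= 1 by rewrite expr_le1.
by have := sqr_ge0 eps; rewrite exprMn !expr2; nra.
Qed.

Definition hits (S : {set elt}) (i : 'I_b) (t : 'I_N) : R :=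
  if inr (i, t) \in S then 1 else 0.

Lemma so_hits (C : secret) (S : {set elt}) :
  so (stateof R C S) = eta * \sum_i hits S i (C.2 i).
Proof.
rewrite /= sum_mem [X in X + _]big1 ?add0r; last first.
  by move=> i _; rewrite big1// => t _ /=; case: ifP.
rewrite mulr_sumr; apply: eq_bigr => i _; rewrite /hits big_mkcond (bigD1 (C.2 i))//=.
rewrite eqxx big1 ?addr0; first by case: ifP; rewrite ?mulr1 ?mulr0.
by move=> t /negbTE ->; case: ifP.
Qed.

(** The mean number of hits is at most [eps * b]. With tilt 1 and e - 1 <= 3 the exponent for four
    times this mean is at most [3 * eps * b - 4 * eps * b]. *)
Lemma card_hits_gt (S : {set elt}) (eps : R) : load S <= eps * (N * b)%:R ->
  #|[set F : {ffun 'I_b -> 'I_N} | 4 * eps * b%:R <= \sum_i hits S i (F i)]|%:R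
  <= N%:R ^+ b * expR (- (eps * b%:R)).
Proof.
move=> Sle.
pose n i : R := \sum_(t | inr (i, t) \in S) 1.
have N0 : 0 < N%:R :> R by rewrite ltr0n.
have := @chernoff_count R 'I_b 'I_N (hits S) (fun i => 3 * n i / N%:R) (4 * eps * b%:R).
rewrite !card_ord => H; apply: (le_trans (H _)) => [i|]; last first.
  rewrite ler_wpM2l ?exprn_ge0 ?ler0n// ler_expR.
  rewrite -mulr_suml -mulr_sumr -/(load S).
  have : load S / N%:R <= eps * b%:R by rewrite ler_pdivrMr// (le_trans Sle)// natrM; lra.
  lra.
have -> : \sum_j expR (hits S i j) = N%:R + (expR 1 - 1) * n i.
  rewrite /n mulr_sumr [X in _ + X]big_mkcond /=.
  have -> : N%:R = \sum_(j < N) (1 : R) by rewrite sumr_const card_ord.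
  rewrite -big_split/=; apply: eq_bigr => j _; rewrite /hits.
  by case: ifP => _; rewrite ?expR0; lra.
have n0 : 0 <= n i by apply: sumr_ge0.
apply: (@le_trans _ _ (N%:R * (1 + 3 * n i / N%:R))); last first.
  by rewrite ler_wpM2l ?ler0n// expR_ge1Dx.
rewrite mulrDr mulr1 lerD2l mulrCA divff ?gt_eqF// mulr1 ler_wpM2r//.
by have := expR1_le4 R; lra.
Qed.

(** A secret is exposed only if [su] deviates to one of two sides, or if [so] is large although the
    load is light; a heavy load conceals [so] through [sp]. These three tails give the factor 3. *)
Lemma card_exposed c rho rho' eps (C0 : secret) (S : {set elt}) : 0 < rho ->
  5 * eps = expR (- rho^-1) -> rho^-1 + 1 / 2 <= eps * N%:R / 2 ->
  #|[set C : secret | hard c rho rho' eps (stateof R C S)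
                   != soft c rho' (stateof R C0 S)]|%:R
  <= #|{: secret}|%:R * (3 * expR (- (eps ^+ 2 * d%:R / 2))).
Proof.
move=> rho0 epsE Nbig.
have r0 : 0 < expR (- rho^-1) by rewrite expR_gt0.
have r1 : expR (- rho^-1) <= 1 by rewrite expR_le1 oppr_le0 invr_ge0 ltW.
have e0 : 0 < eps by move: r0; rewrite -epsE pmulr_rgt0.
have e1 : eps <= 1 by lra.
have b0 := b_gt0 d_gt0 d_le_b.
pose P (l : R) (F : {ffun 'I_d -> bool}) := eps ^+ 2 * d%:R <= \sum_i l * side S i (F i).
pose Q (F : {ffun 'I_b -> 'I_N}) := (load S <= eps * (N * b)%:R) &&
  (4 * eps * b%:R <= \sum_i hits S i (F i)).
have sub : [set C : secret | hard c rho rho' eps (stateof R C S)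
                   != soft c rho' (stateof R C0 S)] \subset
   [set C : secret | P (eps / 2) C.1] :|: [set C : secret | P (- (eps / 2)) C.1]
   :|: [set C : secret | Q C.2].
  apply/fintype.subsetP => C; rewrite !inE (soft_indep c rho' C0 C); apply: contraR.
  rewrite !negb_or -!ltNge => /andP[/andP[h1 h2] h3].
  apply/eqP/hard_eq_soft => //.
    move: h1 h2; rewrite -!mulr_sumr su_side normrM.
    have z0 : 0 < zeta by rewrite invr_gt0 mulr_gt0// ltr0n.
    rewrite (gtr0_norm z0) /pair_weight ler_pdivrMl ?mulr_gt0 ?ltr0n//.
    set s := \sum_i _ => h1 h2.
    have h1' : s < 2 * eps * d%:R.
      rewrite -(ltr_pM2l (divr_gt0 e0 (ltr0Sn R 1))); apply: (lt_le_trans h1).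
      by rewrite expr2; lra.
    have h2' : - s < 2 * eps * d%:R.
      rewrite -(ltr_pM2l (divr_gt0 e0 (ltr0Sn R 1))) mulrN -mulNr; apply: (lt_le_trans h2).
      by rewrite expr2; lra.
    by rewrite ler_norml; apply/andP; split; lra.
  have [Sle|/ltW Sgt] := leP (load S) (eps * (N * b)%:R).
    left; move: h3; rewrite /Q Sle andTb -ltNge so_hits /block_weight => h3.
    rewrite ler_pdivrMl ?mulr_gt0 ?ltr0n//; lra.
  right; apply: (le_trans Nbig); rewrite /block_weight ler_pdivlMl ?mulr_gt0 ?ltr0n//.
  by apply: le_trans Sgt; rewrite natrM; lra.
apply: (@le_trans _ _ ((#|[set C : secret | P (eps / 2) C.1]|
   + #|[set C : secret | P (- (eps / 2)) C.1]| + #|[set C : secret | Q C.2]|)%N)%:R).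
  rewrite ler_nat (leq_trans (subset_leq_card sub))//.
  by rewrite (leq_trans (leq_card_setU _ _))// leq_add2r leq_card_setU.
rewrite !natrD !card_fst card_snd card_prod !natrM !card_ffun !card_ord card_bool !natrX.
set X := expR _.
have l2 : `|eps / 2| = eps / 2 by rewrite gtr0_norm// divr_gt0.
have H1 := card_su_gt S e0 e1 l2.
have l3 : `|- (eps / 2)| = eps / 2 by rewrite normrN.
have H2 := card_su_gt S e0 e1 l3.
have H3 : #|[set a | Q a]|%:R <= N%:R ^+ b * X.
  have [Sle|Sgt] := leP (load S) (eps * (N * b)%:R); last first.
    rewrite (eq_card0 (A := [set a | Q a])) ?mulr_ge0 ?exprn_ge0 ?ler0n ?expR_ge0//.
    by move=> F; rewrite !inE /Q leNgt Sgt.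
  apply: (@le_trans _ _ (#|[set F : {ffun 'I_b -> 'I_N} |
      4 * eps * b%:R <= \sum_i hits S i (F i)]|%:R)).
    by rewrite ler_nat subset_leq_card//; apply/fintype.subsetP => F; rewrite !inE /Q Sle.
  apply: (le_trans (card_hits_gt Sle)).
  rewrite ler_wpM2l ?exprn_ge0 ?ler0n// ler_expR lerN2 -mulrA.
  have : d%:R <= b%:R :> R by rewrite ler_nat.
  have d0 : 0 <= d%:R :> R by rewrite ler0n.
  have ee : eps * eps <= eps by nra.
  rewrite expr2 => db.
  have : eps * eps * d%:R <= eps * b%:R by rewrite ler_pM// mulr_ge0// ltW.
  have := mulr_ge0 (mulr_ge0 (ltW e0) (ltW e0)) d0; lra.
have A0 : 0 <= N%:R ^+ b :> R by rewrite exprn_ge0 ?ler0n.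
have B0 : 0 <= 2 ^+ d :> R by rewrite exprn_ge0.
have K1 := ler_wpM2r A0 H1; have K2 := ler_wpM2r A0 H2; have K3 := ler_wpM2l B0 H3.
apply: (le_trans (lerD (lerD K1 K2) K3)).
rewrite -/X; lra.
Qed.

End Concealment.

(** * Adaptive queries *)

Section Trace.
Variables (R : realType) (n : nat).
Implicit Types (f g : {set 'I_n} -> R) (a : oalg R n).

(** The output is appended to the queries, so that concealment along the transcript covers the value
    of the returned set as well. *)
Fixpoint trace g a : seq {set 'I_n} :=
  match a with
  | Ret X => [:: X]
  | Ask Q k => Q :: trace g (k (g Q))
  end.

Lemma size_trace g a : size (trace g a) = (nqueries g a).+1.
Proof. by elim: a => //= Q k IH; rewrite IH. Qed.

(** While [f] and [g] agree on the queries, both runs follow the same branch; without a disagreement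
    the output on [f] would be the last entry of the transcript on [g]. *)
Lemma run_exposed f g a : f (run f a) != g (run f a) ->
  has (fun S => f S != g S) (trace g a).
Proof.
elim: a => [X|Q k IH] /=; first by rewrite orbF.
by have [-> /IH //|] := eqVneq (f Q) (g Q).
Qed.

End Trace.

(** * Averaging over the randomness of the algorithm and over the secrets *)

Section FiniteProb.
Context d (Omega : measurableType d) (R : realType) (P : probability Omega R).

Lemma sum_prob_le (T : Type) (r : seq T) (E : T -> set Omega) (K : R) :
  (forall x, measurable (E x)) ->
  (forall w, \sum_(x <- r) \1_(E x) w <= K) ->
  \sum_(x <- r) fine (P (E x)) <= K.
Proof.
move=> mE EK; rewrite -lee_fin -sumEFin.
have mf x : measurable_fun setT (EFin \o \1_(E x) : Omega -> \bar R).
  by apply/measurable_EFinP; exact: measurable_indic.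
have f0 x w : (0 <= (\1_(E x) w)%:E :> \bar R)%E by rewrite lee_fin.
have -> : (\sum_(x <- r) (fine (P (E x)))%:E = \int[P]_w \sum_(x <- r) (\1_(E x) w)%:E)%E.
  rewrite ge0_integral_sum//.
  apply: eq_bigr => x _.
  by rewrite integral_indic// setIT fineK// fin_num_measure.
apply: (@le_trans _ _ (\int[P]_w (cst K%:E w))%E); last first.
  rewrite integral_cst// [X in (_ * X)%E](_ : _ = 1%E) ?mule1//.
  exact: probability_setT.
apply: ge0_le_integral => //.
- by move=> w _; apply: sume_ge0 => x _.
- exact: emeasurable_sum.
- by move=> w _; rewrite sumEFin lee_fin.
Qed.

End FiniteProb.

Section Averaging.
Context d (Omega : measurableType d) (R : realType) (P : probability Omega R).
Variables (n : nat) (A : Omega -> oalg R n).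

Definition runs (f : {set 'I_n} -> R) (S : {set 'I_n}) : set Omega :=
  [set w | run f (A w) = S]%classic.

Lemma indic_runs f S w : \1_(runs f S) w = (run f (A w) == S)%:R :> R.
Proof. by rewrite indicE; congr (nat_of_bool _)%:R; apply/idP/eqP; rewrite inE. Qed.

Lemma sum_runs_le1 f : (forall S, measurable (runs f S)) ->
  \sum_S fine (P (runs f S)) <= 1.
Proof.
move=> mf; apply: sum_prob_le => // w.
rewrite (bigD1 (run f (A w)))//= indic_runs eqxx big1 ?addr0// => S.
by rewrite indic_runs eq_sym => /negbTE ->.
Qed.

(* Union bound over the transcript of the run on the reference function [g],
   which does not depend on the hidden instance. *)
Lemma exists_concealed (I : finType) (F : I -> {set 'I_n} -> R) (g : {set 'I_n} -> R)
    (q kap : R) :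
  (0 < #|I|)%N -> 0 <= kap ->
  (forall i S, measurable (runs (F i) S)) ->
  (forall w, (nqueries g (A w)).+1%:R <= q) ->
  (forall S, #|[set i | F i S != g S]|%:R <= #|I|%:R * kap) ->
  exists i, \sum_(S | F i S != g S) fine (P (runs (F i) S)) <= q * kap.
Proof.
move=> I0 kap0 mF qle kle; apply: contrapT => /forallNP H.
have tot : \sum_i \sum_(S | F i S != g S) fine (P (runs (F i) S)) <= #|I|%:R * (q * kap).
  rewrite pair_big_dep /= -big_filter.
  apply: (@sum_prob_le _ _ _ _ _ _ (fun p => runs (F p.1) p.2)) => [p|w].
    exact: mF.
  rewrite big_filter -(pair_big_dep xpredT (fun i S => F i S != g S)
    (fun i S => \1_(runs (F i) S) w)) /=.
  apply: (@le_trans _ _ (\sum_i \sum_(S <- trace g (A w)) (F i S != g S)%:R)).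
    apply: ler_sum => i _.
    (* An exposed output contributes 1 on the left; then the transcript on [g] contains a set
       exposed for the same [i], which contributes 1 on the right. *)
    have [E|E] := boolP (F i (run (F i) (A w)) != g (run (F i) (A w))).
      rewrite (bigD1 (run (F i) (A w)))//= indic_runs eqxx big1 ?addr0; last first.
        by move=> S /andP[_]; rewrite indic_runs eq_sym => /negbTE ->.
      have /hasP[S0 S0t S0E] := run_exposed E.
      by rewrite (big_rem S0)//= S0E lerDl sumr_ge0// => S _; rewrite ler0n.
    rewrite big1 ?sumr_ge0// => S SE.
    rewrite indic_runs; case: eqP => // ES; move: E; rewrite ES.
    by rewrite SE.
  rewrite exchange_big /=.
  apply: (@le_trans _ _ (\sum_(S <- trace g (A w)) #|I|%:R * kap)).
    apply: ler_sum => S _; apply: le_trans (kle S).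
    by rewrite -sum1_card natr_sum big_mkcond [leRHS]big_mkcond /=;
      apply: ler_sum => i _; rewrite inE; case: ifP.
  rewrite big_const_seq count_predT size_trace iter_addr_0 -[leLHS]mulr_natr -mulrA.
  by rewrite ler_wpM2l ?ler0n// [leLHS]mulrC ler_wpM2r.
have : \sum_(i : I) (q * kap) < \sum_i \sum_(S | F i S != g S) fine (P (runs (F i) S)).
  have [i0 _] := card_gt0P I0.
  rewrite (bigD1 i0)//= [ltRHS](bigD1 i0)//= ltr_leD//.
    by rewrite ltNge; apply/negP; exact: H.
  by apply: ler_sum => i _; rewrite leNgt; apply/negP => /ltW; exact: H.
by rewrite sumr_const -[ltLHS]mulr_natl ltNge tot.
Qed.

End Averaging.

(** * Optimal and balanced values *)

Section Values.
Variable R : realType.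
Implicit Types x : state R.

Lemma gsym_bounds x : valid x -> 0 <= gsym x <= 1.
Proof.
move=> vx; have m0 := valid_m0 vx; have m1 := valid_m1 vx; have v2 := valid_v2 vx.
have p0 := ltW (vp0 vx); have p1 := vp1 vx; have v1 := vv1 vx.
have q0 : 0 <= sp x * sv x by rewrite mulr_ge0//; lra.
have q1 : sp x * sv x <= 1 by rewrite mulr_ile1//; lra.
by rewrite /gsym mulr_ge0 ?mulr_ile1 ?subr_ge0//; lra.
Qed.

Lemma fhid_bounds x : valid x -> 0 <= gsym x + hpart x <= 1.
Proof.
move=> vx; have m0 := valid_m0 vx.
have p0 := ltW (vp0 vx); have p1 := vp1 vx; have oge := vo0 vx; have o2 := vo2 vx.
have /ler_normlP[u1 u2] := vum vx; have /ler_normlP[u3 u4] := vu1m vx.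
have E : 2 * (gsym x + hpart x) =
  (1 - sm x - su x) * (1 - sp x) + (1 - sm x + su x) * (1 - (1 - 2 * so x) * sp x).
  rewrite /gsym /hpart; ring.
have c1 : 0 <= (1 - 2 * so x) * sp x <= 1 by rewrite mulr_ge0 ?mulr_ile1//; lra.
have h1 : 0 <= (1 - sm x - su x) * (1 - sp x) <= 1 - sm x - su x.
  by rewrite mulr_ge0 ?ler_piMr//; lra.
have h2 : 0 <= (1 - sm x + su x) * (1 - (1 - 2 * so x) * sp x) <= 1 - sm x + su x.
  by case/andP: c1 => ? ?; rewrite mulr_ge0 ?ler_piMr//; lra.
lra.
Qed.

Lemma slack_bounds x : valid x -> 0 <= slack x <= 3.
Proof.
move=> vx; have m0 := valid_m0 vx; have m1 := valid_m1 vx; have v2 := valid_v2 vx.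
have p0 := ltW (vp0 vx); have p1 := vp1 vx; have v1 := vv1 vx.
have q0 : 0 <= sp x * sv x by rewrite mulr_ge0//; lra.
have q1 : sp x * sv x <= 1 by rewrite mulr_ile1//; lra.
have h1 : 0 <= (2 - sm x) * (1 - sp x * sv x) <= 2 * 1.
  by rewrite mulr_ge0 ?ler_pM//; lra.
have h2 : 0 <= sm x * (2 - sm x) <= 1 by apply/andP; split; nra.
by rewrite /slack; lra.
Qed.

Lemma cut_bounds eps x : 0 <= eps -> valid x -> 0 <= cut eps x <= 2.
Proof.
move=> e0 vx; have m0 := valid_m0 vx; have m1 := valid_m1 vx.
have /ler_normlP[u1 u2] := vum vx.
have s0 := sqpos_ge0 (su x - eps); have s1 : sqpos (su x - eps) <= 1.
  by apply: sqpos_le1; lra.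
have : 0 <= sm x * (1 - sm x) <= 1 by apply/andP; split; nra.
by rewrite /cut; lra.
Qed.

Lemma convex_comb (a b t : R) : 0 <= a <= 1 -> 0 <= b <= 1 -> 0 <= t <= 1 ->
  0 <= (1 - t) * a + t * b <= 1.
Proof. by move=> /andP[? ?] /andP[? ?] /andP[? ?]; apply/andP; split; nra. Qed.

Lemma hard_bounds (c rho rho' eps : R) x : 0 <= c -> 2 * c <= 1 -> 0 <= rho ->
  0 <= rho' <= 1 -> 0 <= eps -> valid x -> 0 <= hard c rho rho' eps x <= 5.
Proof.
move=> c0 c1 r0 r1 e0 vx.
have hc := cut_bounds e0 vx; have hs := slack_bounds vx.
have := convex_comb (gsym_bounds vx) (fhid_bounds vx) (damp_bounds r0 vx).
rewrite /hard (_ : (1 - damp rho x) * gsym x + damp rho x * (gsym x + hpart x)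
  = gsym x + damp rho x * hpart x); last by ring.
move: (cut _ _) (slack _) (gsym x + _) hc hs => C S G /andP[C0 C2] /andP[S0 S3] /andP[G0 G1].
case/andP: r1 => r1 r2.
have h1 : 0 <= c * C <= c * 2 by rewrite mulr_ge0//= ler_wpM2l.
have h2 : 0 <= (1 - 2 * c) * G <= (1 - 2 * c) * 1.
  by rewrite mulr_ge0 ?subr_ge0//= ler_wpM2l ?subr_ge0.
have h3 : 0 <= rho' * S <= 1 * 3 by rewrite mulr_ge0//= ler_pM.
by move: h1 h2 h3 => /andP[? ?] /andP[? ?] /andP[? ?]; apply/andP; split; lra.
Qed.

Lemma soft_ge0 (c rho' : R) x : 0 <= c -> 2 * c <= 1 -> 0 <= rho' -> valid x ->
  0 <= soft c rho' x.
Proof.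
move=> c0 c1 r0 vx; have m0 := valid_m0 vx; have m1 := valid_m1 vx.
have /andP[s0 _] := slack_bounds vx; have /andP[g0 _] := gsym_bounds vx.
have c2 : 0 <= 1 - 2 * c by rewrite subr_ge0.
have m2 : 0 <= 1 - sm x by rewrite subr_ge0.
rewrite /soft; move: (gsym x) (slack x) g0 s0 (1 - 2 * c) (1 - sm x) c2 m2.
by move=> ? ? ? ? ? ? ? ?; rewrite !(addr_ge0, mulr_ge0).
Qed.

Lemma soft_D2 (zeta eta c rho' : R) k l x : 0 < eta -> eta <= zeta ->
  0 <= c -> 2 * c <= 1 -> 0 <= rho' -> valid x -> diff2 zeta eta (soft c rho') k l x <= 0.
Proof.
move=> e0 ez c0 c1 r0 vx.
have -> : diff2 zeta eta (soft c rho') k l x =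
  2 * c * (- (2 * (dm zeta k * dm zeta l)))
  + 2 * (1 - 2 * c) * diff2 zeta eta (@gsym R) k l x + rho' * diff2 zeta eta (@slack R) k l x.
  rewrite /diff2 /soft /=; ring.
have hs : diff2 zeta eta (@slack R) k l x <= 0.
  apply: le_trans (slack_D2_le e0 ez vx k l) _.
  by rewrite oppr_le0 !mulr_ge0 ?sqr_ge0 ?divr_ge0// ltW// (vp0 vx).
have hg := gsym_D2_le0 e0 ez vx k l.
have hd : 0 <= dm zeta k * dm zeta l by rewrite mulr_ge0// (dm_ge0 e0 ez).
have t1 : 2 * c * (- (2 * (dm zeta k * dm zeta l))) <= 0.
  by rewrite mulrN oppr_le0 mulr_ge0// mulr_ge0.
have t2 : 2 * (1 - 2 * c) * diff2 zeta eta (@gsym R) k l x <= 0.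
  by rewrite mulr_ge0_le0// mulr_ge0// subr_ge0.
have t3 : rho' * diff2 zeta eta (@slack R) k l x <= 0 by rewrite mulr_ge0_le0.
by apply: (le_trans (lerD (lerD t1 t2) t3)); rewrite !addr0.
Qed.

(** [y] is the excess of the coverage over c. The coverage bound is conditional because at c = 1/2
    the coverage term has weight zero and the objective is a cut plus slack. *)
Lemma soft_le (c rho' y : R) x : 0 <= c -> 2 * c <= 1 -> 0 <= rho' -> 0 <= y ->
  valid x -> (c < 1 / 2 -> 1 - sp x * sv x <= c + y) ->
  soft c rho' x <= 2 * c * (1 - c) ^+ 2 + 2 * y + 3 * rho'.
Proof.
move=> c0 c1 r0 y0 vx hy; have m0 := valid_m0 vx; have m1 := valid_m1 vx.
have /andP[_ s3] := slack_bounds vx.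
have hs : rho' * slack x <= rho' * 3 by rewrite ler_wpM2l.
have hg : (1 - 2 * c) * gsym x <= (1 - 2 * c) * ((1 - sm x) * c) + y.
  have [ch|ch] := ltP c (1 / 2); last first.
    have -> : 1 - 2 * c = 0 by apply/le_anti/andP; split; lra.
    by rewrite !mul0r add0r.
  have h1 : gsym x <= (1 - sm x) * c + y.
    have : gsym x <= (1 - sm x) * (c + y) by rewrite /gsym; apply: ler_wpM2l; [rewrite subr_ge0|exact: hy].
    have : (1 - sm x) * y <= 1 * y by rewrite ler_wpM2r//; lra.
    lra.
  have c2 : 0 <= 1 - 2 * c by lra.
  have := ler_wpM2l c2 h1.
  have : (1 - 2 * c) * y <= 1 * y by rewrite ler_wpM2r//; lra.
  lra.
(* The two factors depending on [sm] sum to 2 (1 - c). *)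
have amgm : c * ((1 - sm x) * (sm x + 1 - 2 * c)) <= c * (1 - c) ^+ 2.
  by rewrite ler_wpM2l//; have := sqr_ge0 (sm x - c); rewrite !expr2; nra.
rewrite /soft; lra.
Qed.

(** Truncation costs the cut at most [eps], which is below [rho] because e^(-1/rho) <= rho. At [rad]
    = 1/2 the damping factor is at least [1 - 2 * rho]. *)
Lemma hard_opt_ge (c rho rho' eps : R) x : 0 <= c -> 2 * c <= 1 -> 0 < rho -> rho <= 1 ->
  0 <= rho' -> 5 * eps = expR (- rho^-1) -> valid x ->
  sm x = 1 / 2 -> su x = 1 / 2 -> so x = 1 / 2 -> sp x = 1 ->
  1 - c - 3 * rho <= hard c rho rho' eps x.
Proof.
move=> c0 c1 r0 r1 r'0 epsE vx xm xu xo xp.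
have eps0 : 0 < eps by have := expR_gt0 (- rho^-1); rewrite -epsE pmulr_rgt0.
have epsr : 5 * eps <= rho.
  rewrite epsE expRN -[leRHS]invrK lef_pV2 ?posrE ?expR_gt0 ?invr_gt0//.
  by have := expR_ge1Dx rho^-1; lra.
have /andP[s0 _] := slack_bounds vx.
have rs : 0 <= rho' * slack x by rewrite mulr_ge0.
have hcut : 1 / 2 - eps <= cut eps x.
  rewrite /cut xm xu sqpos_pos; last by lra.
  by have := sqr_ge0 eps; rewrite !expr2; nra.
have ln2 : -1 <= ln (1 / 2 : R).
  have : ln (1 + 1 : R) <= 1 by apply: le_ln1Dx; lra.
  by rewrite div1r lnV ?posrE//; have -> : (1 + 1 : R) = 2 by []; lra.
have lamE : 1 - rho <= lam rho x.
  rewrite /lam /rad xp xu xo mul1r.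
  have -> : (1 / 2 : R) ^+ 2 + (1 / 2) ^+ 2 = 1 / 2 by rewrite !expr2; lra.
  by have := ler_wpM2l (ltW r0) ln2; lra.
have Mge : 1 - 2 * rho <= damp rho x.
  rewrite /damp sqpos_pos; last by lra.
  have : (1 - rho) ^+ 2 <= lam rho x ^+ 2 by rewrite ler_sqr ?nnegrE; lra.
  by have := sqr_ge0 rho; rewrite !expr2; nra.
have /andP[M0 M1] := damp_bounds (ltW r0) vx.
have hmain : (1 - 2 * rho) / 2 <= gsym x + damp rho x * hpart x.
  rewrite /gsym /hpart xm xu xo xp.
  have v2 := valid_v2 vx; have v1 := vv1 vx.
  by move: (damp _ _) Mge M0 M1 (sv x) v2 v1 => M Mge M0 M1 v v2 v1; nra.
have h1 : c * (1 / 2 - eps) <= c * cut eps x by rewrite ler_wpM2l.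
have c2 : 0 <= 1 - 2 * c by rewrite subr_ge0.
have h2 := ler_wpM2l c2 hmain.
have h3 : c * eps <= 1 * eps by rewrite ler_wpM2r ?(ltW eps0)//; lra.
have h4 : c * rho >= 0 by rewrite mulr_ge0// ltW.
rewrite /hard; move: (cut _ _) (slack _) (gsym x + _) h1 h2 rs => A B G h1 h2 rs.
lra.
Qed.

End Values.

(** * The planted optimum and the coverage within the budget *)

Section Budget.
Variables (R : realType) (d kap N : nat).
Hypotheses (d_gt0 : (0 < d)%N) (kap_gt0 : (0 < kap)%N).

Local Notation b := (kap * d)%N.
Local Notation elt := (elt d b N).
Local Notation secret := (secret d b N).

Lemma d_le_b : (d <= b)%N. Proof. by rewrite leq_pmull. Qed.

Definition opt (C : secret) : {set elt} :=
  [set z | match kindof C z with KA | KO => true | _ => false end].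

Lemma card_opt (C : secret) : (#|opt C| <= (kap.+1) * d)%N.
Proof.
rewrite -sum1_card.
have -> : (\sum_(z in opt C) 1 = \sum_(i < d) \sum_(t : bool) (t == C.1 i)
   + \sum_(i < b) \sum_(t < N) (t == C.2 i))%N.
  rewrite big_mkcond big_sumType/= !pair_bigA/=.
  by congr (_ + _)%N; apply: eq_bigr => -[i t] _; rewrite inE /=; case: (t == _).
under eq_bigr do rewrite -big_mkcond big_pred1_eq.
under [X in (_ + X)%N]eq_bigr do rewrite -big_mkcond big_pred1_eq.
by rewrite !sum_nat_const !card_ord !muln1 mulSn.
Qed.

Lemma opt_state (C : secret) : let x := stateof R C (opt C) in
  [/\ sm x = 1 / 2, su x = 1 / 2, so x = 1 / 2 & sp x = 1].
Proof.
have dz : \sum_(i < d) pair_weight R d = 1 / 2.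
  by have := zeta_d R d_gt0; rewrite -mulr_sumr; lra.
have hA (w : elt -> R) (F : 'I_d -> R) : (forall i, w (inl (i, C.1 i)) = F i) ->
    (forall i t, w (inr (i, t)) = 0) -> \sum_(z in opt C) w z = \sum_i F i.
  move=> wF w0; rewrite big_mkcond sum_elt [X in _ + X]big1 ?addr0.
    apply: eq_bigr => i _.
    rewrite (eq_bigr (fun t => if t == C.1 i then F i else 0)) ?sum_pick// => t _.
    by rewrite inE /=; case: eqP => // ->; rewrite wF.
  by move=> i _; rewrite big1// => t _; rewrite w0 if_same.
rewrite /=; split.
- by rewrite (hA _ (fun=> pair_weight R d)) // => [i|i t] /=; [rewrite eqxx|case: ifP].
- by rewrite (hA _ (fun=> pair_weight R d)) // => [i|i t] /=; [rewrite eqxx|case: ifP].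
- rewrite -(eta_b R d_gt0 d_le_b) big_mkcond sum_elt [X in X + _]big1 ?add0r; last first.
    by move=> i _; rewrite big1// => t _; case: ifP => //= _; case: ifP.
  apply: eq_bigr => i _.
  rewrite (eq_bigr (fun t => if t == C.2 i then block_weight R b else 0)) ?sum_pick// => t _.
  by rewrite inE /=; case: eqP.
- by rewrite big1// => z; rewrite inE; case: (kindof C z) => //=; rewrite subr0.
Qed.

(** The uncovered part is at least (1 - eta)^|S| with eta = 1/(2 kap d), so the exponent is about
    (beta/2)(1 + 1/kap). The share of the budget meant for the pairs and the passage from 1 - eta to
    an exponential cost the last summand. *)
Lemma cover_le (beta : R) (C : secret) (S : {set elt}) : 0 <= beta ->
  #|S|%:R <= beta * (kap.+1 * d)%:R ->
  1 - sp (stateof R C S) * sv (stateof R C S) <=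
  1 - expR (- (beta / 2)) + 3 * beta / (2 * kap%:R).
Proof.
move=> beta0 Sle.
have e0 := eta_gt0 R d_gt0 d_le_b; have e1 := eta_le1 R d_gt0 d_le_b.
have k0 : 0 < kap%:R :> R by rewrite ltr0n.
have k1 : 1 <= kap%:R :> R by rewrite ler1n.
have d0 : 0 < d%:R :> R by rewrite ltr0n.
have d1 : 1 <= d%:R :> R by rewrite ler1n.
set eta := block_weight R b in e0 e1.
have q0 : 0 < 1 - eta by lra.
(* With this rate 1 - eta >= e^(-mu), since 1/(1 - eta) = 1 + mu. *)
pose mu := eta / (1 - eta).
have mu0 : 0 <= mu by rewrite divr_ge0 ?ltW.
have h1 : expR (- mu) <= 1 - eta.
  rewrite expRN -[leRHS]invrK lef_pV2 ?posrE ?expR_gt0 ?invr_gt0//.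
  apply: le_trans (expR_ge1Dx mu).
  rewrite -[leLHS]div1r ler_pdivrMr// mulrDl mul1r /mu divfK ?subrK//.
  exact: lt0r_neq0.
have h2 : expR (- (#|S|%:R * mu)) <= sp (stateof R C S) * sv (stateof R C S).
  rewrite /= -big_split/= -mulrN expRM_natl -prodr_const.
  apply: ler_prod => z _; rewrite expR_ge0/= (le_trans h1)//.
  by case: (kindof C z) => /=; rewrite -/eta; lra.
pose y := 3 * beta / (2 * kap%:R).
have eb : eta * (2 * kap%:R * d%:R) = 1.
  by rewrite /eta /block_weight natrM [2 * (_ * _)]mulrA mulVf // !mulf_neq0 ?gt_eqF.
have h3 : #|S|%:R * mu <= beta / 2 + y.
  apply: (@le_trans _ _ (beta * (kap.+1 * d)%:R * mu)); first by rewrite ler_wpM2r.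
  rewrite /mu mulrA ler_pdivrMr// natrM -natr1.
  have ek : eta * (2 * kap%:R) <= 1.
    by rewrite -[leRHS]eb ler_pM2l// ler_peMr// mulr_ge0// ltW.
  have E1 : beta * ((kap%:R + 1) * d%:R) * eta * (2 * kap%:R) = beta * (kap%:R + 1).
    have -> : beta * ((kap%:R + 1) * d%:R) * eta * (2 * kap%:R) =
      beta * (kap%:R + 1) * (eta * (2 * kap%:R * d%:R)) by ring.
    by rewrite eb mulr1.
  rewrite -(ler_pM2r (mulr_gt0 (ltr0Sn R 1) k0)) E1.
  have -> : (beta / 2 + y) * (1 - eta) * (2 * kap%:R) =
    beta * ((kap%:R + 3) * (1 - eta)).
    by rewrite /y; field; rewrite gt_eqF.
  rewrite ler_wpM2l//.
  nra.
have h4 : expR (- (beta / 2)) - y <= expR (- (#|S|%:R * mu)).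
  apply: (@le_trans _ _ (expR (- (beta / 2) - y))); last by rewrite ler_expR; lra.
  rewrite expRD; have := expR_ge1Dx (- y).
  have y0 : 0 <= y by rewrite /y divr_ge0// mulr_ge0//.
  have b1 : expR (- (beta / 2)) <= 1 by rewrite expR_le1 oppr_le0 divr_ge0.
  have := expR_ge0 (- (beta / 2)); move: (expR _) (expR _) b1 => E F b1 E0 Fy; nra.
rewrite -/y; lra.
Qed.

End Budget.

(** * The lower bound *)

Section HardInstance.
Variables (R : realType) (beta c e rho eps q : R) (n d kap N : nat).
Hypotheses (beta_ge0 : 0 <= beta) (c_ge0 : 0 <= c) (c_le : 2 * c <= 1).
Hypothesis cE : c < 1 / 2 -> 1 - expR (- (beta / 2)) = c.
Hypotheses (e_gt0 : 0 < e) (e_le1 : e <= 1) (rho_gt0 : 0 < rho) (rho_le1 : rho <= 1).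
Hypothesis beta_kap : beta <= e * kap%:R.
Hypothesis rho_kap : 18400 * rho * kap%:R ^+ 2 <= e.
Hypothesis epsE : 5 * eps = expR (- rho^-1).
Hypothesis N_big : rho^-1 + 1 / 2 <= eps * N%:R / 2.
Hypotheses (d_gt0 : (0 < d)%N) (kap_gt0 : (0 < kap)%N) (N_gt0 : (0 < N)%N).
Hypothesis d_big : 200 <= expR (- rho^-1) * d%:R.
Hypothesis n_big : (d * (2 + N * kap) <= n)%N.
Hypothesis q_small : q * (3 * expR (- (eps ^+ 2 * d%:R / 2))) <= e.

Local Notation b := (kap * d)%N.
Local Notation elt := (elt d b N).
Local Notation secret := (secret d b N).
Local Notation zeta := (pair_weight R d).
Local Notation eta := (block_weight R b).

Let d_le_b : (d <= b)%N := d_le_b d kap_gt0.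
Let eta_gt0 : 0 < eta := eta_gt0 R d_gt0 d_le_b.
Let eta_le_zeta : eta <= zeta := eta_le_zeta R d_gt0 d_le_b.

Lemma card_elt : (#|{: elt}| <= n)%N.
Proof.
apply: leq_trans n_big; rewrite card_sum !card_prod !card_ord card_bool.
by rewrite mulnDr leq_add2l mulnAC (mulnC N) mulnC.
Qed.

Definition embed (z : elt) : 'I_n := widen_ord card_elt (enum_rank z).

Lemma embed_inj : injective embed.
Proof. by move=> x y /(congr1 val) /= /val_inj /enum_rank_inj. Qed.

Definition f_hard (C : secret) := pull embed (hard c rho e eps) C.
Definition f_soft (C : secret) := pull embed (soft c e) C.

Let eps_gt0 : 0 < eps.
Proof. by have := expR_gt0 (- rho^-1); rewrite -epsE pmulr_rgt0. Qed.

Lemma zetaE : zeta = kap%:R * eta.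
Proof.
rewrite /pair_weight /block_weight natrM; field.
by rewrite !pnatr_eq0 -!lt0n d_gt0 kap_gt0.
Qed.

Lemma f_hard_nonneg C : nonneg_fun (f_hard C).
Proof.
apply: pull_nonneg => // x vx.
have e01 : 0 <= e <= 1 by rewrite ltW.
by have /andP[] := hard_bounds c_ge0 c_le (ltW rho_gt0) e01 (ltW eps_gt0) vx.
Qed.

Lemma f_hard_submodular C : submodular (f_hard C).
Proof.
apply: (pull_submodular embed_inj d_gt0 d_le_b) => k l x vx vk vl vkl.
apply: (hard_D2 eta_gt0 eta_le_zeta) => //; first exact: ltW.
  (* Here [400 * zeta] is 200/d, whence the constant in [d_big]; the last condition is [rho_kap]
     with [zeta = kap * eta]. *)
  rewrite /pair_weight invfM mulrA ler_pdivrMr ?ltr0n//.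
  by apply: le_trans d_big; rewrite ler_pdivrMr//; lra.
rewrite zetaE exprMn mulrA ler_wpM2r ?sqr_ge0//.
Qed.

Lemma f_soft_nonneg C : nonneg_fun (f_soft C).
Proof. by apply: pull_nonneg => // x vx; exact: soft_ge0 (ltW e_gt0) vx. Qed.

Lemma f_soft_submodular C : submodular (f_soft C).
Proof.
apply: (pull_submodular embed_inj d_gt0 d_le_b) => k l x vx vk vl vkl.
exact: (soft_D2 _ _ eta_gt0 eta_le_zeta c_ge0 c_le (ltW e_gt0) vx).
Qed.

Lemma f_hard_opt C : exists2 T : {set 'I_n}, (#|T| <= kap.+1 * d)%N &
  1 - c - 3 * rho <= f_hard C T.
Proof.
exists (embed @: opt C).
  by rewrite card_imset; [exact: card_opt|exact: embed_inj].
have preE : embed @^-1: (embed @: opt C) = opt C.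
  apply/setP => z; rewrite inE; apply/imsetP/idP => [[y yC /embed_inj ->//]|zC].
  by exists z.
rewrite /f_hard /pull preE.
have [h1 h2 h3 h4] := opt_state R d_gt0 kap_gt0 C.
apply: hard_opt_ge => //; first exact: ltW.
exact: stateof_valid.
Qed.

Lemma f_soft_le C (S : {set 'I_n}) : #|S|%:R <= beta * (kap.+1 * d)%:R ->
  f_soft C S <= 2 * c * (1 - c) ^+ 2 + 6 * e.
Proof.
move=> Sle; have k0 : 0 < kap%:R :> R by rewrite ltr0n.
pose y := 3 * beta / (2 * kap%:R).
have y0 : 0 <= y by rewrite /y divr_ge0// mulr_ge0.
have ye : y <= 3 / 2 * e by have bk := beta_kap; rewrite /y ler_pdivrMr ?mulr_gt0//; lra.
have vx := stateof_valid R d_gt0 d_le_b C (embed @^-1: S).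
have := soft_le c_ge0 c_le (ltW e_gt0) y0 vx.
rewrite /f_soft /pull => H; apply: (le_trans (H _)); last by lra.
move=> /cE <-; apply: cover_le => //.
apply: le_trans Sle; rewrite ler_nat.
rewrite -(card_imset _ embed_inj); apply: subset_leq_card.
by apply/fintype.subsetP => z /imsetP[y' ]; rewrite inE => ? ->.
Qed.

Context disp (Omega : measurableType disp) (P : probability Omega R).
Variable A : Omega -> oalg R n.
Hypothesis A_meas : forall f S, nonneg_fun f -> submodular f -> measurable (runs A f S).
Hypothesis A_size : forall f w, nonneg_fun f -> submodular f ->
  #|run f (A w)|%:R <= beta * (kap.+1 * d)%:R.
Hypothesis A_fast : forall f w, nonneg_fun f -> submodular f ->
  (nqueries f (A w)).+1%:R <= q.

(** The expectation is split by the output. Concealed outputs have value at most the symmetric bound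
    plus [6 * e]; exposed ones have value at most 5 and total probability at most [e], which gives
    [11 * e]. *)
Lemma exists_hard : exists f : {set 'I_n} -> R, [/\ nonneg_fun f, submodular f,
  exists2 T : {set 'I_n}, (#|T| <= kap.+1 * d)%N & 1 - c - 3 * rho <= f T &
  \sum_S fine (P (runs A f S)) * f S <= 2 * c * (1 - c) ^+ 2 + 11 * e].
Proof.
pose C0 : secret := ([ffun=> true], [ffun=> Ordinal N_gt0]).
have [C HC] : exists C, \sum_(S | f_hard C S != f_soft C0 S)
     fine (P (runs A (f_hard C) S)) <= q * (3 * expR (- (eps ^+ 2 * d%:R / 2))).
  apply: exists_concealed.
  - by apply/card_gt0P; exists C0.
  - by rewrite mulr_ge0 ?expR_ge0.
  - by move=> C S; apply: A_meas; [exact: f_hard_nonneg|exact: f_hard_submodular].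
  - by move=> w; apply: A_fast; [exact: f_soft_nonneg|exact: f_soft_submodular].
  - by move=> S; exact: card_exposed.
exists (f_hard C); split; [exact: f_hard_nonneg|exact: f_hard_submodular|exact: f_hard_opt|].
set V := 2 * c * (1 - c) ^+ 2 + 6 * e.
have V0 : 0 <= V by have := mulr_ge0 c_ge0 (sqr_ge0 (1 - c)); have := e_gt0; rewrite /V; lra.
have pr0 S : 0 <= fine (P (runs A (f_hard C) S)) by rewrite fine_ge0.
apply: (@le_trans _ _ (\sum_S (fine (P (runs A (f_hard C) S)) * V +
   (if f_hard C S != f_soft C0 S then fine (P (runs A (f_hard C) S)) * 5 else 0)))).
  apply: ler_sum => S _.
  have [Sle|Sgt] := leP #|S|%:R (beta * (kap.+1 * d)%:R); last first.
    rewrite (_ : runs A (f_hard C) S = set0).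
      by rewrite measure0 !mul0r if_same addr0.
    apply/seteqP; split => // w /= wS; move: Sgt.
    by rewrite ltNge -wS A_size//; [exact: f_hard_nonneg|exact: f_hard_submodular].
  case: eqP => [->|_] /=.
    by rewrite addr0 ler_wpM2l// f_soft_le.
  have f5 : f_hard C S <= 5.
    have e01 : 0 <= e <= 1 by rewrite ltW.
    have vx := stateof_valid R d_gt0 d_le_b C (embed @^-1: S).
    by have /andP[] := hard_bounds c_ge0 c_le (ltW rho_gt0) e01 (ltW eps_gt0) vx.
  by rewrite -[leLHS]add0r lerD ?mulr_ge0// ler_wpM2l.
rewrite big_split /= -mulr_suml -big_mkcond -mulr_suml.
have h1 : (\sum_S fine (P (runs A (f_hard C) S))) * V <= 1 * V.
  rewrite ler_wpM2r//; apply: sum_runs_le1 => S.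
  by apply: A_meas; [exact: f_hard_nonneg|exact: f_hard_submodular].
have h2 := le_trans HC q_small.
by rewrite /V in h1 *; lra.
Qed.

End HardInstance.

(** * Choice of the parameters and conclusion *)

Lemma nu_parameter (R : realType) (beta : R) : 0 <= beta -> exists c : R,
  [/\ 0 <= c, 2 * c <= 1, c < 1 / 2 -> 1 - expR (- (beta / 2)) = c
    & nu beta = 2 * c * (1 - c)].
Proof.
move=> beta0; rewrite /nu; case: leP => [ble|bgt]; last first.
  by exists (1 / 2); split; lra.
exists (1 - expR (- (beta / 2))); split => //; last by ring.
- by rewrite subr_ge0 expR_le1 oppr_le0 divr_ge0.
- have : 1 / 2 <= expR (- (beta / 2)); last by lra.
  have <- : expR (- ln 2) = 1 / 2 :> R by rewrite expRN lnK ?posrE// div1r.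
  by rewrite ler_expR; lra.
Qed.

Lemma exists_nat_ge (R : realType) (x : R) : exists k : nat, (0 < k)%N /\ x <= k%:R.
Proof.
exists (Num.bound `|x|).+1; split => //.
apply: (le_trans (ler_norm x)); rewrite -natr1.
by rewrite (le_trans (ltW (archi_boundP (normr_ge0 x))))// lerDl.
Qed.

(** The ratio of the leading terms is exactly 2 c (1 - c). The gain [40 * e * (1 - c) >= 20 * e]
    exceeds [11 * e] plus the loss of at most [1.5 * e + 3 * e] from the smaller optimum. *)
Lemma small_params (R : realType) (c e delta rho f : R) : 0 <= c -> 2 * c <= 1 ->
  0 < e -> 40 * e <= 1 -> 40 * e <= delta -> rho <= e ->
  1 - c - 3 * rho <= f ->
  (2 * c * (1 - c) + delta) * f <= 2 * c * (1 - c) ^+ 2 + 11 * e -> False.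
Proof.
move=> c0 c1 e0 e1 ed re fge H.
pose g := 1 - c - 3 * e.
have gf : g <= f by rewrite /g; lra.
have g0 : 0 <= g by rewrite /g; lra.
have nu0 : 0 <= 2 * c * (1 - c) by rewrite !mulr_ge0//; lra.
have nu1 : 2 * c * (1 - c) <= 1 / 2 by have := sqr_ge0 (1 - 2 * c); rewrite expr2; nra.
have : (2 * c * (1 - c) + 40 * e) * g <= (2 * c * (1 - c) + delta) * f.
  by rewrite ler_pM// ?addr_ge0// ?lerD2l//; lra.
rewrite {}/g in gf g0 *.
have ce : 2 * c * (1 - c) * e <= 1 / 2 * e by rewrite ler_wpM2r// ltW.
have ee : e * e <= e * (1 / 40) by rewrite ler_wpM2l ?(ltW e0)//; lra.
have cc : c * e <= 1 / 2 * e by rewrite ler_wpM2r ?(ltW e0)//; lra.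
rewrite expr2 in H *; nra.
Qed.

(** Concealment has twice the exponent of the query bound, so the union bound leaves at most 6
    e^(-x). *)
Lemma small_failure (R : realType) (x e : R) : 0 < e -> 6 / e <= x ->
  (expR x + 1) * (3 * expR (- (2 * x))) <= e.
Proof.
move=> e0 xe; have x0 : 0 <= x by apply: le_trans xe; rewrite divr_ge0// ltW.
have h1 : 1 <= expR x by rewrite -expR0 ler_expR.
have h2 : 6 / e <= expR x by apply: (le_trans xe); have := expR_ge1Dx x; lra.
have -> : - (2 * x) = - x - x by lra.
rewrite expRD expRN; set y := expR x in h1 h2 *.
have y0 : 0 < y by lra.
have h3 : y^-1 <= e / 6.
  by rewrite -[leRHS]invrK lef_pV2 ?posrE ?invr_gt0 ?divr_gt0// invf_div.
have yi : 0 < y^-1 by rewrite invr_gt0.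
have yy : y * y^-1 = 1 by rewrite divff ?gt_eqF.
have y1 : y^-1 <= 1 by rewrite invf_le1.
have -> : (y + 1) * (3 * (y^-1 * y^-1)) = 3 * ((y * y^-1) * y^-1) + 3 * (y^-1 * y^-1) by ring.
rewrite yy mul1r.
have : y^-1 * y^-1 <= y^-1 * 1 by rewrite ler_wpM2l ?(ltW yi).
lra.
Qed.

Lemma exists_smoothing (R : realType) (kap e : R) : 1 <= kap -> 0 < e ->
  exists rho : R, [/\ 0 < rho, rho <= e & 18400 * rho * kap ^+ 2 <= e].
Proof.
move=> k1 e0; have k2 : 1 <= kap ^+ 2 by exact: exprn_ege1.
have k0 : 0 < kap ^+ 2 by apply: lt_le_trans k2.
have K1 : 1 <= 18400 :> R by rewrite ler1n.
move: 18400%:R K1 => K K1; have K0 : 0 < K by apply: lt_le_trans K1.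
have kK1 : 1 <= kap ^+ 2 * K by rewrite -[leLHS]mulr1 ler_pM.
exists (e / kap ^+ 2 / K); split.
- by rewrite !divr_gt0.
- by rewrite ler_pdivrMr// ler_pdivrMr// -mulrA [K * _]mulrC ler_peMr// ltW.
- by rewrite [K * _]mulrC divfK ?gt_eqF// divfK// gt_eqF.
Qed.

Lemma exists_blocks (R : realType) (rho eps : R) : 0 < eps ->
  exists N : nat, (0 < N)%N /\ rho^-1 + 1 / 2 <= eps * N%:R / 2.
Proof.
move=> eps0; have [N [N0 Nge]] := exists_nat_ge ((2 * rho^-1 + 1) / eps).
by exists N; split => //; move: Nge; rewrite ler_pdivrMr//; lra.
Qed.

Lemma exponent_le (R : realType) (eps L n d : R) : 0 < L -> n <= 2 * L * d ->
  2 * (eps ^+ 2 / (8 * L) * n) <= eps ^+ 2 * d / 2.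
Proof.
move=> L0 nLd; have -> : 2 * (eps ^+ 2 / (8 * L) * n) = eps ^+ 2 / (4 * L) * n.
  by field; rewrite gt_eqF.
have -> : eps ^+ 2 * d / 2 = eps ^+ 2 / (4 * L) * (2 * L * d).
  by field; rewrite gt_eqF.
by rewrite ler_wpM2l// divr_ge0 ?sqr_ge0// mulr_ge0// ltW.
Qed.

Lemma divn_half (L n : nat) : (0 < L)%N -> (2 * L <= n)%N -> (n <= 2 * L * (n %/ L))%N.
Proof.
move=> L0 nL; have := divn_eq n L; have := ltn_pmod n L0.
have : (2 <= n %/ L)%N by rewrite leq_divRL.
move: (n %/ L)%N (n %% L)%N => d m d2 mL nE.
rewrite nE -mulnA mul2n -addnn [(L * d)%N]mulnC leq_add2l.
by rewrite (leq_trans (ltnW mL))// leq_pmull// ltnW.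
Qed.

Theorem theorem5p28 (R : realType) (beta delta : R) :
  0 <= beta -> 0 < delta ->
  exists c : R, 0 < c /\ exists n0 : nat, forall n : nat, (n0 <= n)%N ->
  forall (d : measure_display) (Omega : measurableType d)
         (P : probability Omega R) (A : nat -> Omega -> oalg R n),
  (* measurability of the output of the randomized algorithm *)
  (forall (B : nat) (f : {set 'I_n} -> R) (S : {set 'I_n}),
      nonneg_fun f -> submodular f ->
      measurable [set w : Omega | run f (A B w) = S]%classic) ->
  (* (nu(beta)+delta, beta)-bicriteria guarantee *)
  (forall (B : nat) (f : {set 'I_n} -> R),
      nonneg_fun f -> submodular f ->
      (forall w, (#|run f (A B w)|%:R <= beta * B%:R)) /\
      (forall OPT : {set 'I_n}, (#|OPT| <= B)%N ->
         (forall T : {set 'I_n}, (#|T| <= B)%N -> f T <= f OPT) ->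
         (((nu beta + delta) * f OPT)%:E <=
            \sum_(S : {set 'I_n}) P [set w : Omega | run f (A B w) = S]%classic * (f S)%:E)%E)) ->
  exists (B : nat) (f : {set 'I_n} -> R) (w : Omega),
    nonneg_fun f /\ submodular f /\
    expR (c * n%:R) <= (nqueries f (A B w))%:R.
Proof.
move=> beta0 delta0.
have [c [c0 c1 cE nuE]] := nu_parameter beta0.
(* The constants are fixed in the order [e], [kap], [rho], [eps], [N], each depending on earlier
   ones. Large [kap] makes the pairs a negligible share of the budget, small [rho] lets the slack
   absorb the damping error, large [N] makes hitting [O] by chance costly. Only the number of pairs
   grows with [n]. *)
pose e : R := Num.min delta 1 / 40.
have e_gt0 : 0 < e by rewrite divr_gt0// lt_min delta0 ltr01.
have e40 : 40 * e = Num.min delta 1 by rewrite /e mulrC divfK.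
have e1 : 40 * e <= 1 by rewrite e40 ge_min lexx orbT.
have ed : 40 * e <= delta by rewrite e40 ge_min lexx.
have [kap [kap_gt0 kapge]] := exists_nat_ge (beta / e).
have beta_kap : beta <= e * kap%:R by rewrite mulrC -ler_pdivrMr.
have [rho [rho_gt0 rho_e rho_kap]] : exists rho : R,
    [/\ 0 < rho, rho <= e & 18400 * rho * kap%:R ^+ 2 <= e].
  by apply: exists_smoothing => //; rewrite ler1n.
have e_le1 : e <= 1 by move: e1 e_gt0; clear; lra.
have rho_le1 : rho <= 1 by exact: le_trans rho_e _.
have [r1 r1E] : exists r1 : R, r1 = expR (- rho^-1) by exists (expR (- rho^-1)).
have r1_gt0 : 0 < r1 by rewrite r1E expR_gt0.
have [eps eps5] : exists eps : R, 5 * eps = r1 by exists (r1 / 5); rewrite mulrC divfK.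
have eps_gt0 : 0 < eps by move: r1_gt0; rewrite -eps5 pmulr_rgt0.
have epsE : 5 * eps = expR (- rho^-1) by rewrite eps5.
have [N [N_gt0 N_big]] := exists_blocks rho eps_gt0.
have [L LE] : exists L, L = (2 + N * kap)%N by exists (2 + N * kap)%N.
have L_gt0 : (0 < L)%N by rewrite LE.
have LR_gt0 : 0 < L%:R :> R by rewrite ltr0n.
(* Each pair, with its [kap] blocks, uses [L] ground elements, and rounding gives n <= 2 L d. Hence
   [2 * cf * n] is at most the concealment exponent [eps ^+ 2 * d / 2]. *)
pose cf : R := eps ^+ 2 / (8 * L%:R).
have cf_gt0 : 0 < cf by rewrite divr_gt0 ?exprn_gt0// mulr_gt0.
exists cf; split => //.
have [n1 [_ n1ge]] := exists_nat_ge (2 * L%:R * (200 / r1)).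
have [n2 [_ n2ge]] := exists_nat_ge (6 / e / cf).
(* The three bounds serve the rounding in [n %/ L], the fineness of the pair weights, and the
   smallness of the failure probability. *)
exists (maxn (2 * L) (maxn n1 n2)) => n; rewrite !geq_max => /and3P[nL nn1 nn2].
move=> disp Omega P A Ameas Abic.
(* Denying the conclusion bounds the queries of every run on every nonnegative submodular function,
   in particular on the symmetric instance whose transcript is used. *)
apply: contrapT => no.
pose d := (n %/ L)%N.
have d_half : n%:R <= 2 * L%:R * d%:R :> R.
  by rewrite -[2]/(2%:R) -!natrM ler_nat divn_half.
have d_gt0 : (0 < d)%N by rewrite divn_gt0// (leq_trans _ nL)// leq_pmull.
have d_big : 200 <= expR (- rho^-1) * d%:R.
  rewrite -r1E mulrC -ler_pdivrMr//.
  rewrite -(ler_pM2l (mulr_gt0 (ltr0Sn R 1) LR_gt0)) (le_trans _ d_half)//.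
  by rewrite (le_trans n1ge)// ler_nat.
have n_big : (d * (2 + N * kap) <= n)%N by rewrite -LE leq_trunc_div.
pose q := expR (cf * n%:R) + 1.
have q_small : q * (3 * expR (- (eps ^+ 2 * d%:R / 2))) <= e.
  apply: le_trans (@small_failure R (cf * n%:R) e e_gt0 _).
    rewrite ler_wpM2l ?addr_ge0 ?expR_ge0// ler_wpM2l// ler_expR lerN2.
    exact: exponent_le.
  by rewrite [leRHS]mulrC -ler_pdivrMr// (le_trans n2ge)// ler_nat.
pose B := (kap.+1 * d)%N.
have fast f w : nonneg_fun f -> submodular f -> (nqueries f (A B w)).+1%:R <= q.
  move=> f0 fs; rewrite -natr1 lerD2r leNgt; apply/negP => /ltW lt.
  by apply: no; exists B, f, w.
have [f [f0 fs [T TB Tge] Ef]] := @exists_hard R beta c e rho eps q n d kap N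
  beta0 c0 c1 cE e_gt0 e_le1 rho_gt0 rho_le1 beta_kap rho_kap epsE N_big
  d_gt0 kap_gt0 N_gt0 d_big n_big q_small disp Omega P (A B)
  (fun f S f0 fs => Ameas B f S f0 fs)
  (fun f w f0 fs => (Abic B f f0 fs).1 w) fast.
have s0B : (#|(finset.set0 : {set 'I_n})| <= B)%N by rewrite cards0.
case: (@arg_maxP _ _ _ finset.set0 (fun T : {set 'I_n} => #|T| <= B)%N f s0B).
move=> OPT OPTB OPTmax.
have := (Abic B f f0 fs).2 OPT OPTB OPTmax.
have -> : (\sum_(S : {set 'I_n}) P [set w : Omega | run f (A B w) = S]%classic * (f S)%:E =
  (\sum_S fine (P (runs (A B) f S)) * f S)%:E)%E.
  rewrite -sumEFin; apply: eq_bigr => S _.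
  by rewrite EFinM fineK// fin_num_measure//; exact: Ameas.
rewrite lee_fin nuE => H.
apply: (small_params c0 c1 e_gt0 e1 ed rho_e _ (le_trans H Ef)).
exact: (le_trans Tge (OPTmax T TB)).
Qed.
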